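(* (a) The formal exponential map sends $\mathbf{vect}_1$ to $\mathbf{Diff}_1$, and the resulting map $\exp:\mathbf{vect}_1\to\mathbf{Diff}_1$ is analytic. (b) There is a neighborhood of the unity $x$ in $\mathbf{Diff}_1$ on which the formal logarithm takes values in $\mathbf{vect}_1$, and the resulting logarithmic map from this neighborhood to $\mathbf{vect}_1$ is analytic.
   Context: $\overline{\mathbf{Diff}}$ is the group (under substitution) of formal power series $\gamma(x)=x+\sum_{j\ge 2}a_jx^j$, $a_j\in\mathbb{R}$. $W_1$ is the Banach space of real sequences $(a_2,a_3,\dots)$ with norm $\sum_{j\ge 2}|a_j|/j!<\infty$. $\mathbf{Diff}_1$ is the set of $\gamma\in\overline{\mathbf{Diff}}$ with $(a_2,a_3,\dots)\in W_1$; it is identified with the Banach space $W_1$ by taking coefficients. $\overline{\mathbf{vect}}$ is the Lie algebra of formal vector fields $\mathcal{L}=\sum_{j\ge 1}b_jL_j$, $b_j\in\mathbb{R}$, $L_j=x^{j+1}\frac{d}{dx}$, acting on the space $\overline V=\mathbb{R}[[x]]$ of formal power series. $\mathbf{vect}_1\subset\overline{\mathbf{vect}}$ consists of those with $\sum_{j\ge1}\frac{|b_j|}{(j+1)!}<\infty$; it is a Banach space with this sum as norm. For $\gamma\in\overline{\mathbf{Diff}}$ let $T(\gamma):\overline V\to\overline V$, $T(\gamma)F(x)=F(\gamma(x))$. The formal exponential and logarithm: for $\mathcal{L}\in\overline{\mathbf{vect}}$ the operator $\sum_{k\ge0}\mathcal{L}^k/k!$ on $\overline V$ is well defined (as $\mathcal{L}$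 strictly raises the order in $x$) and equals $T(\gamma)$ for a unique $\gamma\in\overline{\mathbf{Diff}}$, denoted $\exp(\mathcal{L})$; this is a bijection $\overline{\mathbf{vect}}\to\overline{\mathbf{Diff}}$ whose inverse is $\gamma\mapsto\ln T(\gamma)=\sum_{k\ge1}\frac{(-1)^{k-1}}{k}(T(\gamma)-1)^k$. (This bijectivity is a known fact.) ''Analytic'' means real analytic between (open subsets of) real Banach spaces. *)

(* Defs.v *)
From HB Require Import structures.
From mathcomp Require Import all_boot all_order all_algebra.
From mathcomp Require Import all_classical all_reals all_analysis.

Set Implicit Arguments.
Unset Strict Implicit.
Unset Printing Implicit Defensive.

Import Order.TTheory GRing.Theory Num.Theory.
Import numFieldNormedType.Exports.

Local Open Scope classical_set_scope.
Local Open Scope ring_scope.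

(* F : fps R stands for the formal series \sum_n F n x^n. *)
Definition fps (R : realType) : Type := nat -> R.

Section FormalSeries.
Context {R : realType}.
Implicit Types (F G : fps R) (a b : nat -> R).

Definition fps_one : fps R := fun n => (n == 0)%N%:R.

Definition fps_X : fps R := fun n => (n == 1)%N%:R.

Definition fps_mul F G : fps R :=
  fun n => \sum_(i < n.+1) F i * G (n - i)%N.

Definition fps_pow G (k : nat) : fps R := iter k (fps_mul G) fps_one.

Definition fps_deriv F : fps R := fun n => n.+1%:R * F n.+1.

(* F(G(x)).  It is used only when G has no constant term: G^k then starts in
   degree >= k, so that the terms with k > n do not contribute to x^n. *)
Definition fps_comp F G : fps R :=
  fun n => \sum_(k < n.+1) F k * fps_pow G k n.

(* Sequences a_2, a_3, ... and b_1, b_2, ... are both indexed from 0: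
   a_j is [a (j - 2)] and b_j is [b (j - 1)]. *)

(* gamma(x) = x + \sum_(j >= 2) a_j x^j *)
Definition diff_series a : fps R :=
  fun n => match n with 0 => 0 | 1 => 1 | i.+2 => a i end.

(* T(gamma) F = F o gamma *)
Definition subst_op a : fps R -> fps R := fun F => fps_comp F (diff_series a).

(* \sum_(j >= 1) b_j x^(j+1) d/dx *)
Definition vfield_op b : fps R -> fps R := fun F =>
  fps_mul (fun n => if n is i.+2 then b i else 0) (fps_deriv F).

(* Convergence in the formal topology: each coefficient of the partial sums is
   eventually constant. *)
Definition formal_sum (u : nat -> fps R) (S : fps R) : Prop :=
  forall n, \forall N \near \oo, \sum_(k < N) u k n = S n.

(* exp(L) = gamma, i.e. \sum_(k >= 0) L^k / k! = T(gamma), where L and gamma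
   have coefficients b and a. *)
Definition formal_exp b a : Prop :=
  forall F, formal_sum (fun k n => iter k (vfield_op b) F n / k`!%:R)
                       (subst_op a F).

(* ln T(gamma) = L, the sum over k >= 1 being shifted to k >= 0. *)
Definition formal_log a b : Prop :=
  forall F, formal_sum
    (fun k n => (-1) ^+ k / k.+1%:R *
                iter k.+1 (fun G : fps R => fun m => subst_op a G m - G m) F n)
    (vfield_op b F).

Lemma formal_sum_unique (u : nat -> fps R) (S S' : fps R) :
  formal_sum u S -> formal_sum u S' -> S = S'.
Proof.
move=> uS uS'; apply/funext => n.
by near \oo => N; rewrite -(near (uS n) N _)// (near (uS' n) N _).
Unshelve. all: by end_near. Qed.

Lemma subst_op_X a : subst_op a fps_X = diff_series a.
Proof.
apply/funext => -[|n]; rewrite /subst_op /fps_comp /fps_X.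
  by rewrite big_ord1 mul0r.
rewrite (bigD1 (@Ordinal n.+2 1 isT))//= mul1r big1 ?addr0; last first.
  by move=> i; rewrite -val_eqE/= => /negPf ->; rewrite mul0r.
rewrite /fps_pow /= /fps_mul big_ord_recr/= subnn /fps_one eqxx mulr1 big1 ?add0r//.
by move=> i _; rewrite subn_eq0 leqNgt ltn_ord mulr0.
Qed.

Lemma vfield_op_X b n : vfield_op b fps_X n.+2 = b n.
Proof.
rewrite /vfield_op /fps_mul big_ord_recr/= subnn /fps_deriv /fps_X mul1r mulr1.
rewrite big1 ?add0r// => i _.
by rewrite eqSS subn_eq0 leqNgt ltn_ord !mulr0.
Qed.

Lemma formal_exp_unique b a a' : formal_exp b a -> formal_exp b a' -> a = a'.
Proof.
move=> /(_ fps_X) + /(_ fps_X) => /formal_sum_unique/[apply].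
by rewrite !subst_op_X => aa'; apply/funext => n; move/(congr1 (@^~ n.+2)): aa'.
Qed.

Lemma formal_log_unique a b b' : formal_log a b -> formal_log a b' -> b = b'.
Proof.
move=> /(_ fps_X) + /(_ fps_X) => /formal_sum_unique/[apply].
by move=> bb'; apply/funext => n; rewrite -vfield_op_X bb' vfield_op_X.
Qed.

End FormalSeries.

Section W1.
Context {R : realType}.
Implicit Types a b : nat -> R.

Definition W1_term a : nat -> R := fun i => `|a i| / (i.+2)`!%:R.

Definition W1_pred : {pred nat -> R} :=
  [pred a | `[< cvgn (series (W1_term a)) >]].

Lemma W1_predP a : reflect (cvgn (series (W1_term a))) (a \in W1_pred).
Proof. exact: asboolP. Qed.

Lemma W1_term_ge0 a i : 0 <= W1_term a i.
Proof. by rewrite divr_ge0. Qed.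

Lemma W1_termZ (l : R) a : W1_term (l *: a) = `|l| *: W1_term a.
Proof.
by apply/funext => i; rewrite /W1_term fctE -[in LHS]/(l * a i) normrM -mulrA.
Qed.

Lemma W1_termD a b i : W1_term (a + b) i <= (W1_term a + W1_term b) i.
Proof. by rewrite !fctE /W1_term -mulrDl ler_wpM2r// ler_normD. Qed.

Lemma is_cvg_W1_termD a b : a \in W1_pred -> b \in W1_pred ->
  cvgn (series (W1_term a + W1_term b)).
Proof. by move=> /W1_predP ca /W1_predP cb; exact: is_cvg_seriesD. Qed.

Lemma W1_submod_closed : submod_closed W1_pred.
Proof.
split=> [|l a b /W1_predP ca bW].
  apply/W1_predP; rewrite (_ : W1_term 0 = 0); last first.
    by apply/funext => i; rewrite /W1_term normr0 mul0r.
  by rewrite (_ : series 0 = cst 0)//; [exact: is_cvg_cst|];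
    apply/funext => n; rewrite /series/= big1.
apply/W1_predP.
apply: (series_le_cvg (W1_term_ge0 _) _ (W1_termD _ _)).
  by move=> i; rewrite addr_ge0 ?W1_term_ge0.
apply: is_cvg_W1_termD => //; apply/W1_predP.
by rewrite W1_termZ; exact: is_cvg_seriesZ.
Qed.

HB.instance Definition _ := GRing.isSubmodClosed.Build R _ W1_pred
  W1_submod_closed.

End W1.

Record W1 (R : realType) : Type := MkW1 {
  W1_seq :> nat -> R ;
  _ : W1_seq \in @W1_pred R
}.

HB.instance Definition _ (R : realType) := [isSub for @W1_seq R].
HB.instance Definition _ (R : realType) := [Choice of W1 R by <:].
HB.instance Definition _ (R : realType) := [SubChoice_isSubLmodule of W1 R by <:].

Section W1_normed.
Context {R : realType}.
Implicit Types a b : W1 R.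

Lemma W1P a : cvgn (series (W1_term a)).
Proof. by apply/W1_predP; exact: (valP a). Qed.

Definition W1_norm a : R := limn (series (W1_term a)).

Lemma W1_norm_ub a n : series (W1_term a) n <= W1_norm a.
Proof.
apply: nondecreasing_cvgn_le; last exact: W1P.
by apply: nondecreasing_series => i _ _; exact: W1_term_ge0.
Qed.

Lemma W1_normD a b : W1_norm (a + b) <= W1_norm a + W1_norm b.
Proof.
rewrite /W1_norm -lim_seriesD; [|exact: W1P..].
apply: ler_lim; [exact: W1P|exact/is_cvg_seriesD/W1P/W1P|].
by apply: nearW => n; apply: ler_sum => i _; exact: W1_termD.
Qed.

Lemma W1_normZ (l : R) a : W1_norm (l *: a) = `|l| * W1_norm a.
Proof.
by rewrite /W1_norm -[W1_seq (l *: a)]/(l *: W1_seq a) W1_termZ lim_seriesZ;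
  [|exact: W1P].
Qed.

Lemma W1_coord_le a i : `|a i| <= (i.+2)`!%:R * W1_norm a.
Proof.
rewrite -ler_pdivrMl ?ltr0n ?fact_gt0// mulrC.
apply: le_trans (W1_norm_ub a i.+1).
by rewrite /series/= big_nat_recr//= lerDr sumr_ge0// => k _; exact: W1_term_ge0.
Qed.

Lemma W1_norm_eq0 a : W1_norm a = 0 -> a = 0.
Proof.
move=> a0; apply/val_inj/funext => i /=; apply/eqP.
by rewrite -normr_le0 (le_trans (W1_coord_le a i))// a0 mulr0.
Qed.

HB.instance Definition _ :=
  Lmodule_isNormed.Build R (W1 R) W1_normD W1_normZ W1_norm_eq0.

Lemma W1_normE a : `|a| = limn (series (W1_term a)).
Proof. by []. Qed.

Lemma W1_complete (F : set_system (W1 R)) :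
  ProperFilter F -> cauchy F -> cvg F.
Proof.
move=> FF /cauchyP Fc.
pose l i : R := lim ((fun a : W1 R => a i) @ F).
have Fl i : (fun a : W1 R => a i) @ F --> l i.
  suff : cvg ((fun a : W1 R => a i) @ F) by [].
  apply/cauchy_cvgP/cauchyP => e e0.
  have d0 : 0 < e / (i.+2)`!%:R by rewrite divr_gt0 ?ltr0n ?fact_gt0.
  have [a Fa] := Fc _ d0; exists (a i).
  suff : F [set b : W1 R | ball (a i) e (b i)] by [].
  apply: filterS Fa => b; rewrite /= -!ball_normE/= => ab.
  rewrite (le_lt_trans (W1_coord_le (a - b) i))//.
  by rewrite mulrC -ltr_pdivlMr ?ltr0n ?fact_gt0.
have tail e : 0 < e -> \forall a \near F, forall N,
    series (W1_term (W1_seq a - l)) N <= e.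
  move=> e0; have e20 : 0 < e / 2 by rewrite divr_gt0.
  have [a0 Fa0] := Fc _ e20.
  apply: filterS (Fa0) => a Aa N.
  have h : (fun b : W1 R => series (W1_term (a - b)) N) @ F -->
      series (W1_term (W1_seq a - l)) N.
    apply: cvg_big => [|i _]; first exact: add_continuous.
    apply: cvgM; last exact: cvg_cst.
    apply: cvg_norm.
    by apply: cvgB; [exact: cvg_cst|exact: Fl].
  apply: (cvgr_to_le h); apply: filterS (Fa0) => b Ab.
  apply: le_trans (W1_norm_ub (a - b) N) _.
  by rewrite -[leLHS]/(`|a - b|) ltW// (@ball_splitr _ _ a0).
have lW : l \in @W1_pred R.
  have [a al] : exists a : W1 R, forall N, series (W1_term (W1_seq a - l)) N <= 1.
    by have /filter_ex[a] := tail _ ltr01; exists a.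
  rewrite (_ : l = W1_seq a - (W1_seq a - l)); last by rewrite opprB addrC subrK.
  rewrite rpredB ?(valP a)//; apply/W1_predP.
  apply: nondecreasing_is_cvgn; first by
    apply: nondecreasing_series => i _ _; exact: W1_term_ge0.
  by exists 1 => _ [n _ <-]; exact: al.
apply/cvg_ex; exists (MkW1 lW).
apply/cvgrPdist_le => e e0; apply: filterS (tail _ e0) => a al.
rewrite distrC W1_normE; apply: limr_le; first exact: W1P.
exact: nearW.
Qed.

HB.instance Definition _ := Uniform_isComplete.Build (W1 R) W1_complete.

End W1_normed.

(* The norms \sum_(j >= 2) |a_j| / j! and \sum_(j >= 1) |b_j| / (j+1)! agree
   once both sequences are indexed from 0, so Diff_1 (through the coefficients)
   and vect_1 are the same Banach space. *)
Notation Diff1 := W1 (only parsing).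
Notation vect1 := W1 (only parsing).

Lemma Diff1_unity (R : realType) : diff_series (0 : Diff1 R) = fps_X.
Proof. by apply/funext => -[|[|n]]. Qed.

Section Analytic.
Context {R : realType} {E F : normedModType R}.

Definition multilinear n (A : ('I_n -> E) -> F) : Prop :=
  forall (v : 'I_n -> E) (i : 'I_n),
    linear (fun x : E => A (@dfwith _ (fun=> E) v i x)).

(* f is the sum, on the ball of radius r around x, of a power series with
   bounded n-linear terms A n and radius of convergence at least r. *)
Definition analytic_at (f : E -> F) (x : E) : Prop :=
  exists (A : forall n, ('I_n -> E) -> F) (C r : R),
    [/\ 0 < r,
        forall n, multilinear (A n),
        forall n (v : 'I_n -> E),
          `|A n v| <= C / r ^+ n * \prod_(i < n) `|v i| &
        forall h, `|h| < r ->
          series (fun n => A n (fun=> h)) @ \oo --> f (x + h)].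

(* Only the values of f on the open set U matter. *)
Definition analytic_on (U : set E) (f : E -> F) : Prop :=
  forall x, U x -> analytic_at f x.

End Analytic.

(* Main.v *)
(* Weight the series sum F_n x^n by the norm sum |F_n| / n!, and let h have
   order at least 2 in x. The multilinear terms
   (h_1, ..., h_k; F) |-> h_1 ... h_k F^(k) / k! then have norm at most 2^k:
   giving an intermediate product that is still to be multiplied by s of the
   h_i the weights 1 / (n + 2s)!, each multiplication costs a factor 2.
   Both the vector field h d/dx (k = 1 only) and T(x + h) - 1 (all k >= 1, by
   Taylor's formula) are sums of such terms. Hence the coefficients of exp and
   log, as functions of h, are norm-convergent power series, for all h in the
   case of exp and near 0 in the case of log. A power series is analytic inside
   its domain of convergence by recentering.
   On the formal side, a linear operator that does not lower the order is
   determined by its values on the x^j. It remains that the exponential of a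
   derivation is multiplicative, and that ln T is a derivation. *)
From HB Require Import structures.
Require Import Defs.
From mathcomp Require Import all_boot all_order all_algebra.
From mathcomp Require Import all_classical all_reals all_analysis.
From mathcomp Require Import ring lra zify.
Set Implicit Arguments.
Unset Strict Implicit.
Unset Printing Implicit Defensive.
Import Order.TTheory GRing.Theory Num.Theory.
Import numFieldNormedType.Exports.
Local Open Scope classical_set_scope.
Local Open Scope ring_scope.

(* A copy of nat -> R, whose canonical product would be the pointwise one. *)
Definition ser (R : realType) : Type := fps R.
HB.instance Definition _ (R : realType) := GRing.Lmodule.copy (ser R) (nat -> R).

(** * The algebra of formal power series *)

Section Ring.
Context {R : realType}.
Implicit Types F G H : ser R.

Definition trunc N F : {poly R} := \poly_(i < N) F i.

Lemma coef_trunc N F i : (i < N)%N -> (trunc N F)`_i = F i.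
Proof. by rewrite coef_poly => ->. Qed.

(** Coefficient n of a product involves only coefficients up to n, so commutativity and
    associativity are inherited from polynomials. *)
Lemma trunc_mul N F G n : (n < N)%N ->
  (trunc N F * trunc N G)`_n = (fps_mul F G : ser R) n.
Proof.
move=> nN; rewrite coefM; apply: eq_bigr => i _.
rewrite !coef_trunc//; first by rewrite (leq_ltn_trans (leq_subr _ _)).
by rewrite (leq_ltn_trans _ nN)// -ltnS.
Qed.

Lemma ser_mulC : commutative (fps_mul : ser R -> ser R -> ser R).
Proof.
by move=> F G; apply/funext => n; rewrite -!(@trunc_mul n.+1)// mulrC.
Qed.

Lemma ser_mulA : associative (fps_mul : ser R -> ser R -> ser R).
Proof.
move=> F G H; apply/funext => n.
have -> : fps_mul F (fps_mul G H) n = (trunc n.+1 F * (trunc n.+1 G * trunc n.+1 H))`_n.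
  rewrite coefM; apply: eq_bigr => i _.
  by rewrite coef_trunc// trunc_mul// ltnS leq_subr.
rewrite mulrA coefM; apply: eq_bigr => i _.
by rewrite trunc_mul// coef_trunc// ltnS leq_subr.
Qed.

Lemma ser_mul1 : left_id (fps_one : ser R) fps_mul.
Proof.
move=> F; apply/funext => n; rewrite /fps_mul big_ord_recl/= mul1r subn0.
by rewrite big1 ?addr0// => i _; rewrite mul0r.
Qed.

Lemma ser_mulD : left_distributive (fps_mul : ser R -> ser R -> ser R) +%R.
Proof.
move=> F G H; apply/funext => n.
by rewrite /fps_mul -[RHS]big_split/=; apply: eq_bigr => i _; rewrite mulrDl.
Qed.

Lemma ser_one_neq0 : (fps_one : ser R) != 0.
Proof. by apply/eqP => /(congr1 (@^~ 0)) /eqP; rewrite oner_eq0. Qed.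

HB.instance Definition _ := GRing.Zmodule_isComNzRing.Build (ser R)
  ser_mulA ser_mulC ser_mul1 ser_mulD ser_one_neq0.

Lemma ser_scaleAl (a : R) F G : a *: (F * G) = (a *: F) * G.
Proof.
apply/funext => n; rewrite -[LHS]/(a * \sum_(i < n.+1) F i * G (n - i)%N) mulr_sumr.
by apply: eq_bigr => i _; rewrite mulrA.
Qed.
HB.instance Definition _ := GRing.Lmodule_isLalgebra.Build R (ser R) ser_scaleAl.
HB.instance Definition _ := GRing.Lalgebra_isComAlgebra.Build R (ser R).

Lemma serM F G n : (F * G) n = \sum_(i < n.+1) F i * G (n - i)%N.
Proof. by []. Qed.
Lemma serD F G n : (F + G) n = F n + G n. Proof. by []. Qed.
Lemma serZ (a : R) F n : (a *: F) n = a * F n. Proof. by []. Qed.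
Lemma ser_sum I (r : seq I) (P : pred I) (F : I -> ser R) n :
  (\sum_(i <- r | P i) F i) n = \sum_(i <- r | P i) F i n.
Proof. by apply: (big_morph (fun F : ser R => F n)). Qed.

End Ring.

(** * Operators on formal series *)

Section Order.
Context {R : realType}.
Implicit Types (F G : ser R) (P Q : ser R -> ser R).

Definition vanishes k F := forall i, (i < k)%N -> F i = 0.

Lemma vanishes_mul k l F G :
  vanishes k F -> vanishes l G -> vanishes (k + l) (F * G).
Proof.
move=> Fk Gl n nkl; rewrite serM big1// => i _.
have [ik|ki] := ltnP i k; first by rewrite Fk// mul0r.
by rewrite Gl ?mulr0//; move: (ltn_ord i); lia.
Qed.

Lemma vanishes_exp k F m : vanishes k F -> vanishes (k * m) (F ^+ m).
Proof.
move=> Fk; elim: m => [|m IHm]; first by move=> n; rewrite muln0.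
by rewrite exprS mulnS; exact: vanishes_mul.
Qed.

(** For a linear operator, causal means that coefficient n of the result depends only on
    coefficients up to n of the argument. If the operator is raising, sums of its iterates are
    finite in each coefficient. *)
Definition causal P := forall k F, vanishes k F -> vanishes k (P F).
Definition raising P := forall k F, vanishes k F -> vanishes k.+1 (P F).

Lemma raising_causal P : raising P -> causal P.
Proof. by move=> hP k F /hP h i ik; rewrite h// ltnW. Qed.

Lemma causal_mulr G : causal ( *%R ^~ G).
Proof.
by move=> k F Fk; rewrite -(addn0 k); apply: vanishes_mul.
Qed.

Lemma causal_mull G : causal ( *%R G).
Proof.
by move=> k F Fk; rewrite -(add0n k); apply: vanishes_mul.
Qed.

Lemma raising_iter P k F : raising P -> vanishes k (iter k P F).
Proof. by move=> hP; elim: k => [//|k IHk]; exact: hP. Qed.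

Definition serX : ser R := fps_X.

Lemma serX_mul F n : (serX * F) n = if n is m.+1 then F m else 0.
Proof.
rewrite serM; case: n => [|n]; first by rewrite big_ord1 mul0r.
rewrite (bigD1 (@Ordinal n.+2 1 isT))//= /serX /fps_X eqxx mul1r subn1/= big1 ?addr0//.
by move=> i; rewrite -val_eqE/= => /negPf ->; rewrite mul0r.
Qed.

Lemma serXn_mul k F n : (serX ^+ k * F) n = if (k <= n)%N then F (n - k)%N else 0.
Proof.
elim: k n => [|k IHk] n; first by rewrite expr0 mul1r subn0.
by rewrite exprS -mulrA serX_mul; case: n.
Qed.

Lemma serXnE k n : (serX ^+ k) n = (n == k)%:R.
Proof.
rewrite -[serX ^+ k]mulr1 serXn_mul -[1 : ser R]/(@fps_one R) /fps_one.
by case: leqP => kn; [congr (nat_of_bool _)%:R; lia|case: eqP => //; lia].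
Qed.

Lemma vanishes_sub_poly N F : vanishes N (F - \sum_(k < N) F k *: serX ^+ k).
Proof.
move=> i iN; rewrite serD -[(- _) i]/(- (_ i)) ser_sum (bigD1 (Ordinal iN))//=.
rewrite big1 ?addr0 => [|j].
  by rewrite serZ serXnE eqxx mulr1 subrr.
by rewrite -val_eqE/= eq_sym serZ serXnE => /negPf ->; rewrite mulr0.
Qed.

(** Each F is a polynomial plus a remainder of order greater than n, and causality keeps the
    remainder out of coefficient n. *)
Lemma causal_linear_eq P Q : linear P -> linear Q -> causal P -> causal Q ->
  (forall j, P (serX ^+ j) = Q (serX ^+ j)) -> P =1 Q.
Proof.
move=> lP lQ cP cQ PQ F; apply/funext => n.
pose PL : {linear ser R -> ser R} := HB.pack P (GRing.isLinear.Build _ _ _ _ P lP).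
pose QL : {linear ser R -> ser R} := HB.pack Q (GRing.isLinear.Build _ _ _ _ Q lQ).
pose S := \sum_(k < n.+1) F k *: serX ^+ k.
have H : vanishes n.+1 (F - S) := vanishes_sub_poly _.
have PS : PL S = QL S.
  by rewrite /S !linear_sum; apply: eq_bigr => k _; rewrite !linearZ/= PQ.
rewrite -[F](subrK S); move: (F - S) H => D H.
rewrite -[P]/(PL : _ -> _) -[Q]/(QL : _ -> _) !raddfD !serD.
congr (_ + _); last exact: (congr1 (fun G : ser R => G n) PS).
exact: etrans (cP _ _ H _ (ltnSn n)) (esym (cQ _ _ H _ (ltnSn n))).
Qed.

Lemma linear_iter k P : linear P -> linear (iter k P).
Proof.
by move=> lP; elim: k => [|k IHk] a F G//=; rewrite IHk lP.
Qed.

(** The divided derivative F^(k) / k!. *)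
Definition hasse k F : ser R := fun n => 'C(n + k, k)%:R * F (n + k)%N.

Lemma hasse_linear k : linear (hasse k).
Proof.
move=> a F G; apply/funext => n.
rewrite serD serZ /hasse -[(a *: F + G) _]/(a * F _ + G _); ring.
Qed.
HB.instance Definition _ k := GRing.isLinear.Build R (ser R) (ser R) *:%R
  (hasse k) (hasse_linear k).

Lemma hasse_Xn k j : hasse k (serX ^+ j) = serX ^+ (j - k) *+ 'C(j, k).
Proof.
have -> : serX ^+ (j - k) *+ 'C(j, k) = 'C(j, k)%:R *: serX ^+ (j - k) :> ser R.
  by rewrite scaler_nat.
apply/funext => n; rewrite serZ /hasse !serXnE -!natrM; congr (_%:R).
have [<-|njk] := eqVneq (n + k)%N j; first by rewrite addnK eqxx.
by have [jk|kj] := ltnP j k; [rewrite (@bin_small j)//; lia|lia].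
Qed.

(** [phi ^+ K] starts in degree 2K while K derivatives lower degrees by K only, so coefficient n
    sees F only up to n - K. *)
Lemma vanishes_hasse_term K n F phi : vanishes 2 phi ->
  (forall i, (i + K <= n)%N -> F i = 0) -> (phi ^+ K * hasse K F) n = 0.
Proof.
move=> phi2 FK; rewrite serM big1// => i _.
have [ik|ki] := ltnP i (2 * K); first by rewrite (vanishes_exp phi2 ik) mul0r.
by rewrite /hasse FK ?mulr0//; move: (ltn_ord i); lia.
Qed.

(** For phi of order at least 2, this is F(x + phi) - F if all c_k are 1, and phi F' if c_0 = 1 is
    the only nonzero one. The terms with k >= n do not reach coefficient n, so the cut-off loses
    nothing. *)
Definition taylor (c : nat -> R) (phi : ser R) F : ser R := fun n =>
  \sum_(k < n) c k * (phi ^+ k.+1 * hasse k.+1 F) n.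

Section Taylor.
Variables (c : nat -> R) (phi : ser R).
Hypothesis phi2 : vanishes 2 phi.

Lemma taylor_widen N F n : (n <= N)%N ->
  taylor c phi F n = \sum_(k < N) c k * (phi ^+ k.+1 * hasse k.+1 F) n.
Proof.
move=> nN; rewrite /taylor (big_ord_widen _ (fun k => c k * (phi ^+ k.+1 * hasse k.+1 F) n) nN).
rewrite big_mkcond/=; apply: eq_bigr => k _; case: ltnP => // nk.
by rewrite vanishes_hasse_term ?mulr0// => i; lia.
Qed.

Lemma taylor_linear : linear (taylor c phi).
Proof.
move=> a F G; apply/funext => n.
rewrite serD serZ /taylor mulr_sumr -big_split/=; apply: eq_bigr => k _.
by rewrite linearP mulrDr -scalerAr serD serZ; ring.
Qed.

Lemma taylor_raising : raising (taylor c phi).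
Proof.
move=> k F Fk n nk; rewrite /taylor big1// => i _.
rewrite vanishes_hasse_term ?mulr0// => j jn; apply: Fk; lia.
Qed.

End Taylor.

End Order.

(** * Substitutions and vector fields as operators *)

Section Substitution.
Context {R : realType}.
Implicit Types (F G : ser R) (a b : nat -> R).

Definition tail a : ser R := fun n => if n is i.+2 then a i else 0.

Lemma vanishes_tail a : vanishes 2 (tail a).
Proof. by move=> [|[|]]. Qed.

Lemma diff_seriesE a : diff_series a = serX + tail a :> ser R.
Proof.
apply/funext => -[|[|n]]; rewrite serD /tail /serX /fps_X/= ?add0r ?addr0//.
Qed.

Lemma fps_powE G k : fps_pow G k = G ^+ k.
Proof. by elim: k => [//|k IHk]; rewrite exprS -IHk. Qed.

Lemma vanishes_diff_series a : vanishes 1 (diff_series a : ser R).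
Proof. by move=> [|]. Qed.

Lemma subst_op_linear a : linear (subst_op a : ser R -> ser R).
Proof.
move=> l F G; apply/funext => n.
rewrite serD serZ /subst_op /fps_comp mulr_sumr -big_split/=; apply: eq_bigr => k _.
by rewrite serD serZ; ring.
Qed.

Lemma subst_op_causal a : causal (subst_op a : ser R -> ser R).
Proof.
move=> k F Fk n nk; rewrite /subst_op /fps_comp big1// => i _.
by rewrite Fk ?mul0r//; move: (ltn_ord i); lia.
Qed.

Lemma subst_op_Xn a j : subst_op a (serX ^+ j) = (diff_series a : ser R) ^+ j.
Proof.
apply/funext => n; rewrite /subst_op /fps_comp.
have [jn|nj] := ltnP j n.+1.
  rewrite (bigD1 (Ordinal jn))//= serXnE eqxx mul1r fps_powE big1 ?addr0// => i.
  by rewrite -val_eqE/= serXnE => /negPf ->; rewrite mul0r.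
have := @vanishes_exp _ 1 (diff_series a) j (@vanishes_diff_series a).
rewrite mul1n => -> //; rewrite big1// => i _.
rewrite serXnE; case: eqP => [ij|]; last by rewrite mul0r.
by move: (ltn_ord i); rewrite ij; lia.
Qed.

(** Both sides are linear and causal in each factor, so monomials suffice, one factor at a time.
    There the claim is the law of exponents for powers of gamma. *)
Lemma subst_opM a F G :
  subst_op a (F * G) = (subst_op a F : ser R) * (subst_op a G : ser R).
Proof.
pose T : ser R -> ser R := subst_op a.
have lT : linear T := @subst_op_linear a.
have cT : causal T := @subst_op_causal a.
rewrite -![subst_op a _]/(T _).
have lr H : linear ( *%R ^~ H : ser R -> ser R) by move=> l A B; rewrite mulrDl scalerAl.
have ll H : linear ( *%R H : ser R -> ser R) by move=> l A B; rewrite mulrDr scalerAr.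
have TX j : T (serX ^+ j) = (diff_series a : ser R) ^+ j := subst_op_Xn a j.
have h1 j : (fun H => T (serX ^+ j * H)) =1 (fun H => T (serX ^+ j) * T H).
  apply: causal_linear_eq => [l A B|l A B|k A Ak|k A Ak|i].
  - by rewrite ll lT.
  - by rewrite lT ll.
  - exact/cT/causal_mull.
  - exact/causal_mull/cT.
  - by rewrite -exprD !TX exprD.
apply: (causal_linear_eq (P := fun H => T (H * G)) (Q := fun H => T H * T G)) F
   => [l A B|l A B|k A Ak|k A Ak|j].
- by rewrite lr lT.
- by rewrite lT lr.
- exact/cT/causal_mulr.
- exact/causal_mulr/cT.
- exact: h1.
Qed.

(** On x^j, Taylor's formula is the binomial expansion of (x + [tail a])^j. *)
Lemma subst_op_taylor a F :
  subst_op a F = F + taylor (fun=> 1) (tail a) F :> ser R.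
Proof.
have t2 := @vanishes_tail a.
apply: (causal_linear_eq (P := subst_op a)
  (Q := fun F => F + taylor (fun=> 1) (tail a) F)) => [|l A B|||j].
- exact: subst_op_linear.
- by rewrite taylor_linear scalerDr addrACA.
- exact: subst_op_causal.
- move=> k A Ak i ik; rewrite serD Ak// (raising_causal (taylor_raising _ t2) Ak)//.
  by rewrite addr0.
- rewrite subst_op_Xn diff_seriesE exprDn; apply/funext => n.
  (* The Taylor sum stops at n and the binomial sum at j; both are widened to j + n. *)
  rewrite serD (taylor_widen _ t2 _ (leq_addl j n)) big_ord_recl/=.
  rewrite subn0 expr0 mulr1 bin0 mulr1n serD; congr (_ + _).
  rewrite ser_sum (big_ord_widen _ (fun k => (serX ^+ (j - k.+1) * tail a ^+ k.+1 *+ 'C(j, k.+1)) n) (leq_addr n j)).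
  rewrite big_mkcond/=; apply: eq_bigr => k _; rewrite mul1r hasse_Xn.
  rewrite [serX ^+ _ * _]mulrC mulrnAr; case: ltnP => // jk.
  by rewrite bin_small// mulr0n.
Qed.

Lemma vfield_op_taylor b F :
  vfield_op b F = taylor (fun k => (k == 0)%:R) (tail b) F :> ser R.
Proof.
have -> : vfield_op b F = tail b * (hasse 1 F) :> ser R.
  rewrite /vfield_op -[fps_mul _ _]/((tail b : ser R) * (fps_deriv F : ser R)); congr (_ * _).
  by apply/funext => n; rewrite /fps_deriv /hasse addn1 bin1.
apply/funext => n; rewrite (taylor_widen _ (@vanishes_tail b) _ (leqnSn n)).
rewrite big_ord_recl/= mul1r expr1 big1 ?addr0// => i _.
by rewrite mul0r.
Qed.

Lemma vfield_op_linear b : linear (vfield_op b : ser R -> ser R).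
Proof.
move=> l F G; rewrite -[LHS]/(vfield_op b (l *: F + G) : ser R) vfield_op_taylor taylor_linear.
by rewrite -!vfield_op_taylor.
Qed.

Lemma vfield_op_raising b : raising (vfield_op b : ser R -> ser R).
Proof.
move=> k F Fk; rewrite vfield_op_taylor.
exact: (taylor_raising _ (@vanishes_tail b)).
Qed.

Lemma vfield_op_Xn b j : vfield_op b (serX ^+ j) = serX ^+ j.-1 * tail b *+ j :> ser R.
Proof.
rewrite /vfield_op -[fps_mul _ _]/((tail b : ser R) * (fps_deriv (serX ^+ j) : ser R)).
rewrite mulrC -mulrnAl; congr (_ * _).
have <- : hasse 1 (serX ^+ j) = fps_deriv (serX ^+ j) :> ser R.
  by apply/funext => n; rewrite /fps_deriv /hasse addn1 bin1.
by rewrite hasse_Xn bin1 subn1.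
Qed.

Definition derivation (D : ser R -> ser R) :=
  forall F G, D (F * G) = D F * G + F * D G.

Lemma derivation_Xn (D : ser R -> ser R) j : derivation D -> linear D ->
  D (serX ^+ j) = serX ^+ j.-1 * D serX *+ j.
Proof.
move=> dD lD.
have D0 : D 1 = 0.
  by have := dD 1 1; rewrite !mul1r !mulr1 -[LHS]addr0 => /addrI <-.
elim: j => [|j IHj]; first by rewrite expr0 mulr0n.
rewrite exprS dD IHj mulrnAr mulrA -exprS mulrS [D _ * _]mulrC.
by case: j {IHj} => [|j]; rewrite ?mulr0n.
Qed.

(** By the product rule D x determines D on all powers of x, and causality extends this to all
    series. This is how ln T is recognized as a vector field. *)
Lemma derivation_vfield_op (D : ser R -> ser R) b :
  derivation D -> linear D -> causal D -> D serX = tail b ->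
  D =1 vfield_op b.
Proof.
move=> dD lD cD Db; apply: causal_linear_eq => //.
- exact: vfield_op_linear.
- exact/raising_causal/vfield_op_raising.
- by move=> j; rewrite derivation_Xn// vfield_op_Xn Db.
Qed.

Lemma vfield_op_derivation b : derivation (vfield_op b : ser R -> ser R).
Proof.
move=> F G; pose V : ser R -> ser R := vfield_op b.
have lV : linear V := @vfield_op_linear b.
have cV : causal V := raising_causal (@vfield_op_raising b).
rewrite -![vfield_op b _]/(V _).
have VX j : V (serX ^+ j) = serX ^+ j.-1 * tail b *+ j := vfield_op_Xn b j.
have lr H : linear ( *%R ^~ H : ser R -> ser R) by move=> l A B; rewrite mulrDl scalerAl.
have ll H : linear ( *%R H : ser R -> ser R) by move=> l A B; rewrite mulrDr scalerAr.
have h1 j : (fun H => V (serX ^+ j * H)) =1 (fun H => V (serX ^+ j) * H + serX ^+ j * V H).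
  apply: causal_linear_eq => [l A B|l A B|k A Ak|k A Ak n nk|i].
  - by rewrite ll lV.
  - by rewrite lV !ll scalerDr addrACA.
  - exact/cV/causal_mull.
  - by rewrite serD (causal_mull _ Ak)// add0r (causal_mull _ (cV _ _ Ak)).
  (* Exponent 0 is treated apart: there [j.-1] is truncated, and the multiplicity 0 removes the
     term. *)
  - rewrite -exprD !VX; case: j => [|j]; first by rewrite mulr0n mul0r add0r mul1r.
    case: i => [|i]; first by rewrite mulr0n mulr0 addr0 addn0 mulr1.
    have e1 : serX ^+ j * tail b * serX ^+ i.+1 = serX ^+ (j + i.+1) * tail b.
      by rewrite mulrAC -exprD.
    have e2 : serX ^+ j.+1 * (serX ^+ i * tail b) = serX ^+ (j + i.+1) * tail b.
      by rewrite mulrA -exprD addSnnS.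
    by rewrite mulrnAl mulrnAr e1 e2 -mulrnDr.
apply: (causal_linear_eq (P := fun H => V (H * G)) (Q := fun H => V H * G + H * V G)) F
   => [l A B|l A B|k A Ak|k A Ak n nk|j].
- by rewrite lr lV.
- by rewrite lV !lr scalerDr addrACA.
- exact/cV/causal_mulr.
- by rewrite serD (causal_mulr _ (cV _ _ Ak))// add0r (causal_mulr _ Ak).
- exact: h1.
Qed.

End Substitution.

(** * Formal exponential and logarithm *)

Section FormalExp.
Context {R : realType}.
Implicit Types (F G : ser R) (a b : nat -> R).

Definition iter_fact (D : ser R -> ser R) k F : ser R :=
  (k`!%:R^-1 : R) *: iter k D F.

(** Stopping at k = n is exact for a raising D, since D^k F then has order at least k. *)
Definition exp_op (D : ser R -> ser R) F : ser R := fun n =>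
  \sum_(k < n.+1) iter_fact D k F n.

Section Derivation.
Variable D : ser R -> ser R.
Hypotheses (lD : linear D) (dD : derivation D) (rD : raising D).

Lemma linear_fact k : linear (iter_fact D k).
Proof.
by move=> l F G; rewrite /iter_fact (linear_iter k lD) scalerDr !scalerA [_ * l]mulrC.
Qed.

Lemma iter_factS k F : D (iter_fact D k F) = k.+1%:R *: iter_fact D k.+1 F.
Proof.
have DZ (l : R) H : D (l *: H) = l *: D H.
  have D0 : D 0 = 0 by have := lD (-1) 0 0; rewrite !scaleN1r !addNr.
  by rewrite -[l *: H]addr0 lD D0 addr0.
rewrite /iter_fact DZ scalerA iterS; congr (_ *: _).
by rewrite factS natrM invfM mulrA divff ?mul1r// pnatr_eq0.
Qed.

(** Dividing by m! absorbs the binomial coefficients, so the Leibniz rule for D^m becomes a Cauchy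
    product. *)
Lemma iter_fact_leibniz m F G : iter_fact D m (F * G) =
  \sum_(i < m.+1) iter_fact D i F * iter_fact D (m - i) G.
Proof.
pose DL : {linear ser R -> ser R} := HB.pack D (GRing.isLinear.Build _ _ _ _ D lD).
elim: m => [|m IHm]; first by rewrite big_ord1 /iter_fact fact0 invr1 !scale1r.
have m0 : (m.+1%:R : R) != 0 by rewrite pnatr_eq0.
apply: (scalerI m0); rewrite -iter_factS IHm -[D _]/(DL _) linear_sum/=.
have e (i j : nat) : D (iter_fact D i F * iter_fact D j G) =
    i.+1%:R *: (iter_fact D i.+1 F * iter_fact D j G) +
    j.+1%:R *: (iter_fact D i F * iter_fact D j.+1 G).
  by rewrite dD !iter_factS scalerAl scalerAr.
under eq_bigr do rewrite e.
rewrite big_split/= scaler_sumr.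
(* The factor m + 1 is split as i + (m + 1 - i); the two parts match the two terms of the product
   rule. *)
have -> : \sum_(i < m.+2) (m.+1%:R : R) *: (iter_fact D i F * iter_fact D (m.+1 - i) G) =
  \sum_(i < m.+2) (i%:R : R) *: (iter_fact D i F * iter_fact D (m.+1 - i) G) +
  \sum_(i < m.+2) ((m.+1 - i)%N%:R : R) *: (iter_fact D i F * iter_fact D (m.+1 - i) G).
  rewrite -big_split/=; apply: eq_bigr => i _.
  by rewrite -scalerDl -natrD subnKC// -ltnS.
congr (_ + _).
  by rewrite [RHS]big_ord_recl/= scale0r add0r.
rewrite [RHS]big_ord_recr/= subnn scale0r addr0; apply: eq_bigr => i _.
by rewrite subSn// -ltnS.
Qed.

Lemma vanishes_iter_fact k F : vanishes k (iter_fact D k F).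
Proof. by move=> n nk; rewrite /iter_fact serZ (raising_iter _ rD nk) mulr0. Qed.

Lemma exp_op_widen N F n : (n < N)%N ->
  exp_op D F n = \sum_(k < N) iter_fact D k F n.
Proof.
move=> nN; rewrite /exp_op (big_ord_widen _ (fun k => iter_fact D k F n) nN).
rewrite big_mkcond/=; apply: eq_bigr => k _; case: ltnP => // nk.
by rewrite vanishes_iter_fact.
Qed.

Lemma exp_op_linear : linear (exp_op D).
Proof.
move=> l F G; apply/funext => n; rewrite serD serZ /exp_op mulr_sumr -big_split/=.
by apply: eq_bigr => k _; rewrite linear_fact.
Qed.

Lemma exp_op_causal : causal (exp_op D).
Proof.
move=> k F Fk n nk; rewrite /exp_op big1// => i _; rewrite /iter_fact serZ.
have /(_ n nk) -> : vanishes k (iter i D F); last by rewrite mulr0.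
by elim: (nat_of_ord i) => [//|j]; exact/(raising_causal rD).
Qed.

Lemma exp_opM F G : exp_op D (F * G) = exp_op D F * exp_op D G.
Proof.
apply/funext => n.
(* In the coefficients up to n, the exponential is the value at t = 1 of a polynomial in t with
   coefficients D^k H / k!. A product of values is then the value of a product. *)
pose P H : {poly ser R} := \poly_(k < n.+1) iter_fact D k H.
have PE H i : (i < n.+1)%N -> exp_op D H i = (P H).[1] i.
  move=> iN; rewrite (exp_op_widen _ iN) horner_poly ser_sum; apply: eq_bigr => k _.
  by rewrite expr1n mulr1.
have vP H k : vanishes k (P H)`_k.
  by rewrite coef_poly; case: ifP => // _; exact: vanishes_iter_fact.
have -> : (exp_op D F * exp_op D G) n = ((P F).[1] * (P G).[1]) n.
  rewrite !serM; apply: eq_bigr => i _; rewrite !PE//.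
  by rewrite ltnS leq_subr.
have sP : (size (P F * P G)%R <= n.+1 + n.+1)%N.
  rewrite (leq_trans (size_polyMleq _ _))// (leq_trans (leq_pred _))//.
  by apply: leq_add; exact: size_poly.
rewrite -hornerM (horner_coef_wide _ sP) ser_sum big_split_ord/= [X in _ + X]big1.
  rewrite addr0 /exp_op; apply: eq_bigr => k _; rewrite expr1n mulr1 coefM.
  rewrite iter_fact_leibniz; congr (_ n); apply: eq_bigr => i _.
  have iN : (i < n.+1)%N by move: (ltn_ord i) (ltn_ord k); lia.
  have jN : (k - i < n.+1)%N by move: (ltn_ord k); lia.
  by rewrite !coef_poly iN jN.
(* The powers of t beyond n have coefficients of order greater than n in x. *)
move=> k _; rewrite expr1n mulr1 coefM ser_sum big1// => i _.
have := vanishes_mul (vP F i) (vP G (n.+1 + k - i)%N); apply.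
by move: (ltn_ord i); lia.
Qed.

Lemma exp_op1 : exp_op D 1 = 1.
Proof.
have D1 : D 1 = 0 by rewrite -(expr0 serX) derivation_Xn.
have D0 : D 0 = 0 by have := lD (-1) 0 0; rewrite !scaleN1r !addNr.
apply/funext => n; rewrite /exp_op big_ord_recl big1 ?addr0 => [|k _].
  by rewrite /iter_fact/= fact0 invr1 scale1r.
rewrite /iter_fact iterSr D1 serZ; have -> : iter k D 0 = 0; last by rewrite mulr0.
by elim: (nat_of_ord k) => [//|j /= ->].
Qed.

Lemma exp_op_Xn j : exp_op D (serX ^+ j) = exp_op D serX ^+ j.
Proof.
by elim: j => [|j IHj]; rewrite ?expr0 ?exp_op1// !exprS exp_opM IHj.
Qed.

End Derivation.

(** Both exp(L) and T(gamma) are multiplicative, so agreement at x gives agreement at all powers of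
    x, hence everywhere by linearity and causality. *)
Lemma formal_exp_of_X a b :
  (diff_series a : ser R) = exp_op (vfield_op b) serX -> formal_exp b a.
Proof.
move=> ab F n.
have lD := @vfield_op_linear _ b; have dD := @vfield_op_derivation _ b.
have rD := @vfield_op_raising _ b.
have <- : exp_op (vfield_op b) F n = subst_op a F n.
  congr (_ n); apply: (@causal_linear_eq R).
  - exact: exp_op_linear.
  - exact: subst_op_linear.
  - exact: exp_op_causal.
  - exact: subst_op_causal.
  - by move=> j; rewrite subst_op_Xn exp_op_Xn// ab.
exists n.+1 => // N /= nN; rewrite (exp_op_widen rD _ nN); apply: eq_bigr => k _.
by rewrite /iter_fact serZ mulrC.
Qed.

End FormalExp.

(** * The formal logarithm *)

Section FormalLog.
Context {R : realType}.
Implicit Types (F G : ser R) (a b : nat -> R).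

(** The binomial coefficient as a polynomial in its upper argument. *)
Definition bin_poly k : {poly R} :=
  (k`!%:R^-1 : R) *: \prod_(i < k) ('X - (i%:R : R)%:P).

Lemma bin_poly_nat k s : (bin_poly k).[s%:R] = 'C(s, k)%:R.
Proof.
have k0 : (k`!%:R : R) != 0 by rewrite pnatr_eq0 -lt0n fact_gt0.
apply: (mulfI k0); rewrite hornerZ mulrA divff// mul1r -natrM mulnC bin_ffact.
rewrite horner_prod; elim: k {k0} => [|k IHk]; first by rewrite big_ord0.
rewrite big_ord_recr/= IHk ffactnSr natrM !hornerE.
have [ks|sk] := leqP k s; first by rewrite natrB.
by rewrite ffact_small// !mul0r.
Qed.

(** Only the factor ['X] vanishes at 0, so the derivative there is the product (-1)^k k! of the
    other factors over (k + 1)!. These are the coefficients of ln(1 + u), the s-derivative of (1 +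
    u)^s at s = 0. *)
Lemma bin_polyS_deriv0 k : (bin_poly k.+1)^`().[0] = (-1) ^+ k / k.+1%:R.
Proof.
rewrite derivZ hornerZ big_ord_recl/= subr0 derivM derivX mul1r hornerD hornerM.
rewrite hornerX mul0r addr0 horner_prod.
have -> : \prod_(i < k) ('X - ((bump 0 i)%:R : R)%:P).[0] = (-1) ^+ k * k`!%:R.
  elim: k => [|k IHk]; first by rewrite big_ord0 expr0 mulr1.
  by rewrite big_ord_recr/= IHk !hornerE exprS factS natrM /bump/= add1n; ring.
rewrite factS natrM; field.
by rewrite addrC natr1 !pnatr_eq0 /= -lt0n fact_gt0.
Qed.

Lemma poly_nat_eq (p q : {poly R}) : (forall s : nat, p.[s%:R] = q.[s%:R]) -> p = q.
Proof.
move=> pq; apply/eqP; rewrite -subr_eq0; apply/eqP; set r := p - q.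
apply: (@roots_geq_poly_eq0 _ r [seq s%:R | s <- iota 0 (size r)]).
- by apply/allP => _ /mapP[s _ ->]; rewrite rootE hornerD hornerN pq subrr.
- rewrite map_inj_uniq ?iota_uniq// => i j /eqP; rewrite eqr_nat => /eqP //.
- by rewrite size_map size_iota.
Qed.

Variable a : nat -> R.
Let T : ser R -> ser R := subst_op a.
Let U : ser R -> ser R := taylor (fun=> 1) (tail a).

Let TE F : T F = F + U F. Proof. exact: subst_op_taylor. Qed.
Let lU : linear U. Proof. exact: taylor_linear. Qed.
Let rU : raising U. Proof. exact/taylor_raising/vanishes_tail. Qed.

Definition log_op F : ser R := fun n =>
  \sum_(k < n) ((-1) ^+ k / k.+1%:R) * (iter k.+1 U F) n.

Lemma log_op_widen N F n : (n <= N)%N ->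
  log_op F n = \sum_(k < N) ((-1) ^+ k / k.+1%:R) * (iter k.+1 U F) n.
Proof.
move=> nN; rewrite /log_op (big_ord_widen _ (fun k => ((-1) ^+ k / k.+1%:R) * (iter k.+1 U F) n) nN).
rewrite big_mkcond/=; apply: eq_bigr => k _; case: ltnP => // nk.
by rewrite -?iterS (@raising_iter _ U k.+1 F rU n) ?mulr0.
Qed.

Lemma log_op_linear : linear log_op.
Proof.
move=> l F G; apply/funext => n; rewrite serD serZ /log_op mulr_sumr -big_split/=.
apply: eq_bigr => k _; rewrite -?iterS (linear_iter k.+1 lU) serD serZ; ring.
Qed.

Lemma log_op_causal : causal log_op.
Proof.
move=> k F Fk n nk; rewrite /log_op big1// => i _; rewrite -?iterS.
have /(_ n nk) -> : vanishes k (iter i.+1 U F); last by rewrite mulr0.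
by elim: {n nk i} i.+1 => [//|j]; exact/(raising_causal rU).
Qed.

(** Newton's series for T^s = (1 + U)^s applied to F, where the powers of U beyond n do not reach
    coefficient n. *)
Definition power_poly F n : {poly R} := \sum_(k < n.+1) iter k U F n *: bin_poly k.

Lemma power_poly_nat F n s : (power_poly F n).[s%:R] = iter s T F n.
Proof.
rewrite horner_sum.
under eq_bigr do rewrite hornerZ bin_poly_nat.
elim: s F => [|s IHs] F.
  by rewrite big_ord_recl/= bin0 mulr1 big1 ?addr0// => k _; rewrite bin0n mulr0.
(* T^(s+1) F = T^s (F + U F), and Pascal's rule matches the two sides. *)
rewrite iterSr TE -IHs [LHS]big_ord_recl/= [RHS]big_ord_recl/= !bin0.
rewrite serD !mulr1 -addrA; congr (_ + _).
under eq_bigr do rewrite binS natrD mulrDr.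
rewrite big_split/= [LHS]addrC.
have -> : \sum_(i < n) iter i.+1 U (F + U F) n * 'C(s, i.+1)%:R =
   \sum_(i < n) iter i.+1 U F n * 'C(s, i.+1)%:R +
   \sum_(i < n) iter i.+2 U F n * 'C(s, i.+1)%:R.
  rewrite -big_split/=; apply: eq_bigr => i _; rewrite -mulrDl; congr (_ * _).
  have /= := @linear_iter R i.+1 _ lU 1 F (U F); rewrite !scale1r => ->.
  by rewrite serD -iterSr.
rewrite addrCA [LHS]addrC; congr (_ + _).
(* The extra term k = n is zero because U^(n+1) F has order at least n + 1. *)
transitivity (\sum_(k < n.+1) iter k.+1 U F n * 'C(s, k)%:R).
  by rewrite big_ord_recr/= -?iterS (@raising_iter _ U n.+1 F rU n)// mul0r addr0.
by rewrite big_ord_recl/= bin0 mulr1.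
Qed.

Lemma power_poly0 F n : (power_poly F n).[0] = F n.
Proof. exact: (power_poly_nat F n 0). Qed.

Lemma power_poly_deriv0 F n : (power_poly F n)^`().[0] = log_op F n.
Proof.
rewrite raddf_sum horner_sum big_ord_recl/= derivZ /bin_poly big_ord0 derivZ derivC.
rewrite !scaler0 horner0 add0r; apply: eq_bigr => k _.
by rewrite derivZ hornerZ bin_polyS_deriv0 mulrC.
Qed.

Lemma iter_subst_opM s F G : iter s T (F * G) = iter s T F * iter s T G.
Proof. by elim: s => [//|s IHs]; rewrite !iterS IHs; exact: subst_opM. Qed.

(* s |-> T^s F is polynomial in each coefficient, so that multiplicativity of
   T^s extends from natural s to all s; then differentiate at s = 0. *)
Lemma log_op_derivation : derivation log_op.
Proof.
move=> F G; apply/funext => n.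
have E : power_poly (F * G) n =
    \sum_(i < n.+1) power_poly F i * power_poly G (n - i)%N.
  apply: poly_nat_eq => s; rewrite power_poly_nat iter_subst_opM horner_sum.
  by apply: eq_bigr => i _; rewrite hornerM !power_poly_nat.
rewrite -power_poly_deriv0 E raddf_sum horner_sum serD !serM -big_split/=.
apply: eq_bigr => i _; rewrite derivM hornerD !hornerM !power_poly_deriv0.
by rewrite !power_poly0.
Qed.

Lemma formal_log_of_X b : tail b = log_op serX -> formal_log a b.
Proof.
move=> ab F n.
have <- := @derivation_vfield_op _ log_op b log_op_derivation log_op_linear log_op_causal (esym ab) F.
have UE : (fun G : fps R => fun m => subst_op a G m - G m) = U :> (fps R -> fps R).
  apply/funext => G; apply/funext => m.
  have /(congr1 (fun H : ser R => H m)) := TE G; rewrite /T => ->.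
  by rewrite serD addrC addKr.
by exists n => // N nN; rewrite UE (log_op_widen _ nN).
Qed.

End FormalLog.

(** * Recentering of power series *)

Section Multilinear.
Context {R : realType}.

(** Arguments of multilinear maps are infinite sequences, so that adding or removing a first
    argument changes no type. *)
Definition scons (E : Type) (x : E) (w : nat -> E) : nat -> E :=
  fun i => if i is j.+1 then w j else x.

Lemma scons_eta (E : Type) (w : nat -> E) : w = scons (w 0%N) (w \o succn).
Proof. by apply/funext => -[]. Qed.

Lemma scons_cst (E : Type) (x : E) : scons x (fun=> x) = fun=> x.
Proof. by apply/funext => -[]. Qed.

(* A depends only on the first n arguments, and is linear in each of them. *)
Fixpoint mlin (E F : lmodType R) n (A : (nat -> E) -> F) : Prop :=
  if n is m.+1 then
    (forall w, linear (fun x => A (scons x w))) /\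
    (forall x, mlin m (fun w => A (scons x w)))
  else forall w w', A w = A w'.

Section Basics.
Context {E F : lmodType R}.
Implicit Types (A B : (nat -> E) -> F) (w : nat -> E).

Lemma mlin_local n A w w' : mlin n A ->
  (forall i, (i < n)%N -> w i = w' i) -> A w = A w'.
Proof.
elim: n A w w' => [|n IHn] A w w' /=; first by move=> mA _; exact: mA.
move=> [_ mA] ww'; rewrite [w]scons_eta [w']scons_eta ww'//.
by apply: (IHn (fun w => A (scons (w' 0%N) w))) => // i ni; exact: ww'.
Qed.

Definition upd w i x : nat -> E := fun j => if j == i then x else w j.

Lemma mlin_linear n A w i : mlin n A -> (i < n)%N -> linear (fun x => A (upd w i x)).
Proof.
elim: n A w i => [//|n IHn] A w [|i] /= [lA mA] ni.
  have e x : upd w 0 x = scons x (w \o succn) by apply/funext => -[].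
  by move=> a u v; rewrite !e lA.
have e x : upd w i.+1 x = scons (w 0%N) (upd (w \o succn) i x) by apply/funext => -[].
move=> a u v; rewrite !e.
exact: (IHn (fun w' => A (scons (w 0%N) w')) (w \o succn) i).
Qed.

Lemma mlin0 n : mlin n (fun _ : nat -> E => 0 : F).
Proof. by elim: n => [//|n IHn]; split=> // w a u v; rewrite scaler0 addr0. Qed.

Lemma mlinP n (a : R) A B : mlin n A -> mlin n B -> mlin n (fun w => a *: A w + B w).
Proof.
elim: n A B => [|n IHn] A B /=; first by move=> mA mB w w'; rewrite (mA w w') (mB w w').
move=> [lA mA] [lB mB]; split=> [w b u v|x]; last exact: (IHn _ _ (mA x) (mB x)).
by rewrite lA lB !scalerDr !scalerA [a * b]mulrC addrACA.
Qed.

Lemma mlinD n A B : mlin n A -> mlin n B -> mlin n (fun w => A w + B w).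
Proof.
by move=> mA mB; under eq_fun do rewrite -[A _]scale1r; exact: mlinP.
Qed.

Lemma mlinZ n (a : R) A : mlin n A -> mlin n (fun w => a *: A w).
Proof.
by move=> mA; under eq_fun do rewrite -[_ *: _]addr0; exact/mlinP/mlin0.
Qed.

Lemma mlin_sum n (I : Type) (r : seq I) (A : I -> (nat -> E) -> F) :
  (forall i, mlin n (A i)) -> mlin n (fun w => \sum_(i <- r) A i w).
Proof.
move=> mA; elim: r => [|i r IHr].
  by under eq_fun do rewrite big_nil; exact: mlin0.
by under eq_fun do rewrite big_cons; exact: mlinD.
Qed.

Lemma mlin_comp n (G : lmodType R) (j : {linear F -> G}) A :
  mlin n A -> mlin n (fun w => j (A w)).
Proof.
elim: n A => [|n IHn] A /=; first by move=> mA w w'; rewrite (mA w w').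
by move=> [lA mA]; split=> [w a u v|x]; [rewrite lA linearP|exact/IHn/mA].
Qed.

(** It lets multilinearity of maps into [W1] be checked on formal series, where products are
    available. *)
Lemma mlin_inj n (G : lmodType R) (j : {linear F -> G}) A :
  injective j -> mlin n (fun w => j (A w)) -> mlin n A.
Proof.
move=> ij; elim: n A => [|n IHn] A /=; first by move=> mA w w'; apply/ij/mA.
move=> [lA mA]; split=> [w a u v|x]; last exact/IHn/mA.
by apply: ij; rewrite linearP; exact: lA.
Qed.

End Basics.

Section Selection.
Context {E F : lmodType R}.
Variable x : E.
Implicit Types (A B : (nat -> E) -> F).

(* The sum of A(y_0, ..., y_(n-1)) over all the ways to replace n - k of the
   arguments by x and the k remaining ones by v_0, ..., v_(k-1), in order. *)
Fixpoint sel n k A (v : nat -> E) {struct n} : F :=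
  match n, k with
  | 0, 0 => A (fun=> 0)
  | 0, _.+1 => 0
  | m.+1, 0 => sel m 0 (fun w => A (scons x w)) v
  | m.+1, l.+1 => sel m l.+1 (fun w => A (scons x w)) v +
                  sel m l (fun w => A (scons (v 0%N) w)) (v \o succn)
  end.

Lemma sel_linear n k a A B v :
  sel n k (fun w => a *: A w + B w) v = a *: sel n k A v + sel n k B v.
Proof.
elim: n k A B v => [|n IHn] [|k] A B v //=; first by rewrite scaler0 addr0.
by rewrite !IHn scalerDr addrACA.
Qed.

Lemma mlin_sel n k A : mlin n A -> mlin k (sel n k A).
Proof.
elim: n k A => [|n IHn] [|k] A //.
- by move=> _; exact: mlin0.
- by move=> [_ mA]; exact: (IHn 0%N _ (mA x)).
move=> [lA mA].
apply: (@mlinD _ _ k.+1); first exact: (IHn k.+1 _ (mA x)).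
split=> [w a u v|y] /=; last exact: (IHn k _ (mA y)).
rewrite -sel_linear; congr (sel n k _ _); apply/funext => w'.
exact: lA.
Qed.

(** Linearity splits each argument x + h into a choice of x or h, and [sel n k] collects the choices
    with k times h. No k exceeds n, so any N > n gives all of them. *)
Lemma sel_sum n N A h : mlin n A -> (n < N)%N ->
  \sum_(k < N) sel n k A (fun=> h) = A (fun=> x + h).
Proof.
elim: n N A => [|n IHn] [|N] A //.
  move=> mA _; rewrite big_ord_recl big1 ?addr0 => [|i _] //=.
move=> [lA mA] nN; rewrite big_ord_recl/=.
under eq_bigr do rewrite add0n.
rewrite big_split/= addrA.
have := IHn N.+1 _ (mA x) (ltnW nN); rewrite big_ord_recl/= => ->.
rewrite (IHn N (fun w => A (scons h w)))//; last exact: mA.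
rewrite -[A (scons x _)]scale1r -lA scale1r; congr (A _).
exact: scons_cst.
Qed.

End Selection.
End Multilinear.

Section Recentering.
Context {R : realType}.

(** There are C(n, k) selections, each with n - k arguments x; the recursion of [sel] is Pascal's
    rule. *)
Lemma sel_bound (E F : normedModType R) (x : E) n k (A : (nat -> E) -> F) (K : R) v :
  (forall w, `|A w| <= K * \prod_(i < n) `|w i|) ->
  `|sel x n k A v| <= K * 'C(n, k)%:R * `|x| ^+ (n - k) * \prod_(i < k) `|v i|.
Proof.
elim: n k A K v => [|n IHn] k A K v hA.
  case: k => [|k] /=; last by rewrite normr0 mulr0 !mul0r.
  by rewrite (le_trans (hA _))// big_ord0 expr0 big_ord0 !mulr1.
have hs y w : `|A (scons y w)| <= K * `|y| * \prod_(i < n) `|w i|.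
  by rewrite (le_trans (hA _))// big_ord_recl/= mulrA.
case: k => [|k] /=.
  rewrite (le_trans (IHn 0%N _ _ _ (hs x)))// !bin0 !subn0 exprS !mulr1.
  by rewrite mulrA.
rewrite (le_trans (ler_normD _ _))//.
rewrite (le_trans (lerD (IHn k.+1 _ _ _ (hs x)) (IHn k _ _ _ (hs (v 0%N)))))//.
rewrite binS natrD subSS big_ord_recl/=.
set p := \prod_(i < k) _.
(* For k >= n the exponent n - (k + 1) is truncated, but its binomial coefficient is 0. *)
have [kn|nk] := ltnP k n; last first.
  rewrite (@bin_small n k.+1)//; rewrite le_eqVlt; apply/orP; left; apply/eqP; ring.
rewrite -(subnSK kn) exprS le_eqVlt; apply/orP; left; apply/eqP; ring.
Qed.

Lemma sum_geometric_le (t : R) N : 0 <= t < 1 -> \sum_(n < N) t ^+ n <= (1 - t)^-1.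
Proof.
move=> /andP[t0 t1]; have t10 : 0 < 1 - t by rewrite subr_gt0.
rewrite -[leRHS]mul1r ler_pdivlMr//.
have -> : (\sum_(n < N) t ^+ n) * (1 - t) = 1 - t ^+ N.
  elim: N => [|N IHN]; first by rewrite big_ord0 mul0r expr0 subrr.
  by rewrite big_ord_recr/= mulrDl IHN exprS; ring.
by rewrite lerBlDr lerDl exprn_ge0.
Qed.

Lemma geometric_series_cvg (F : completeNormedModType R) (u : nat -> F) (C t : R) :
  0 <= t < 1 -> 0 <= C -> (forall n, `|u n| <= C * t ^+ n) ->
  cvgn (series u) /\ `|limn (series u)| <= C / (1 - t).
Proof.
move=> t01 C0 uC; have /andP[t0 t1] := t01.
have cu : cvgn (series u).
  apply: normed_cvg; apply: (@series_le_cvg _ _ (geometric C t)) => //.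
  - by move=> n /=.
  - by move=> n /=; rewrite mulr_ge0// exprn_ge0.
  - by apply: is_cvg_geometric_series; rewrite ger0_norm.
split=> //; rewrite -lim_norm//; apply: limr_le; first exact: is_cvg_norm.
apply: nearW => N; rewrite (le_trans (ler_norm_sum _ _ _))//.
rewrite (le_trans (ler_sum _ (fun i _ => uC i)))// -mulr_sumr big_mkord.
by rewrite ler_wpM2l// sum_geometric_le.
Qed.

(** The recentered terms are infinite sums of multilinear maps; the identities defining [mlin] pass
    to pointwise limits. *)
Lemma mlin_lim (E : lmodType R) (F : normedModType R) n
    (P : nat -> (nat -> E) -> F) (Q : (nat -> E) -> F) :
  (forall N, mlin n (P N)) -> (forall w, P ^~ w @ \oo --> Q w) -> mlin n Q.
Proof.
elim: n P Q => [|n IHn] P Q /= mP PQ.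
  move=> w w'; have e : P ^~ w = P ^~ w' by apply/funext => N; exact: mP.
  have := PQ w'; rewrite -e => PQ'.
  exact: (@cvg_unique _ (@norm_hausdorff _ F) _ _ _ _ (PQ w) PQ').
split=> [w a u v|x]; last first.
  by apply: (IHn (fun N w => P N (scons x w))) => [N|w]; [case: (mP N)|exact: PQ].
have e : P ^~ (scons (a *: u + v) w) =
    fun N => a *: P N (scons u w) + P N (scons v w).
  by apply/funext => N; exact: (mP N).1.
have := PQ (scons (a *: u + v) w); rewrite e => PQ1.
apply: (@cvg_unique _ (@norm_hausdorff _ F) _ _ _ _ PQ1).
by apply: cvgD; [apply: cvgZr; exact: PQ|exact: PQ].
Qed.

(** The default 0 is harmless, since an [mlin n] map reads only the first n entries. *)
Definition pad (E : lmodType R) n (v : 'I_n -> E) : nat -> E :=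
  fun i => if insub i is Some j then v j else 0.

Lemma pad_dfwith (E : lmodType R) n (v : 'I_n -> E) i x :
  pad (@dfwith _ (fun=> E) v i x) = upd (pad v) i x.
Proof.
apply/funext => j; rewrite /pad /upd; case: insubP => [k kn kj|].
  have [ik|ik] := eqVneq i k.
    by rewrite -ik dfwithin -kj -ik; case: eqP.
  by rewrite dfwithout// -kj val_eqE eq_sym (negPf ik).
by rewrite -leqNgt => nj; case: eqP => // ji; move: nj; rewrite ji leqNgt ltn_ord.
Qed.

Lemma pad_ord (E : lmodType R) n (v : 'I_n -> E) (i : 'I_n) : pad v i = v i.
Proof. by rewrite /pad valK. Qed.

Lemma multilinear_pad (E F : normedModType R) n (A : (nat -> E) -> F) :
  mlin n A -> multilinear (fun v : 'I_n -> E => A (pad v)).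
Proof.
move=> mA v i a x y; rewrite !pad_dfwith.
exact: (mlin_linear _ mA (ltn_ord i)).
Qed.

(** In f(x + h) = sum_n sum_k [sel x n k (A n)] at h, the order of summation is exchanged, which
    geometric bounds in both n and k permit for small h. *)
Lemma power_series_analytic_at (E : normedModType R) (F : completeNormedModType R)
    (A : forall n : nat, (nat -> E) -> F) (f : E -> F) (C r : R) (x : E) :
  0 < r -> (forall n, mlin n (A n)) ->
  (forall n w, `|A n w| <= C / r ^+ n * \prod_(i < n) `|w i|) ->
  (forall h, `|h| < r -> series (fun n => A n (fun=> h)) @ \oo --> f h) ->
  `|x| < r -> analytic_at f x.
Proof.
move=> r0 mA bA Af xr.
have C0 : 0 <= C.
  by have := le_trans (normr_ge0 _) (bA 0%N (fun=> 0)); rewrite big_ord0 expr0 divr1 mulr1.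
(* [r'] is half of the room between |x| and r, so that |x| + r' < r and sums over n are dominated by
   powers of t < 1. *)
pose r' := (r - `|x|) / 2; pose t := (`|x| + r') / r.
have r'0 : 0 < r' by rewrite divr_gt0// subr_gt0.
have t01 : 0 <= t < 1.
  rewrite divr_ge0 ?addr_ge0// ?ltW//= ltr_pdivrMr// mul1r /r'; lra.
have /andP[t0 t1] := t01.
have sb n k v : `|sel x n k (A n) v| <= (C / r' ^+ k * \prod_(i < k) `|v i|) * t ^+ n.
  apply: le_trans (sel_bound _ _ _ (bA n)) _.
  rewrite /t (expr_div_n _ r n).
  (* Times r'^k, the left side is a single term of the binomial expansion of (|x| + r')^n. *)
  have h : 'C(n, k)%:R * `|x| ^+ (n - k) <= (`|x| + r') ^+ n / r' ^+ k.
    rewrite ler_pdivlMr ?exprn_gt0//.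
    have [kn|nk] := ltnP k n.+1; last first.
      by rewrite bin_small// !mul0r exprn_ge0// addr_ge0// ltW.
    rewrite exprDn (bigD1 (Ordinal kn))//= mulr_natl mulrnAl lerDl sumr_ge0// => i _.
    by rewrite mulrn_wge0// mulr_ge0// exprn_ge0// ltW.
  have p0 : 0 <= \prod_(i < k) `|v i| by exact: prodr_ge0.
  have c0 : 0 <= C / r ^+ n by rewrite divr_ge0// exprn_ge0// ltW.
  rewrite -(mulrA (C / _)) (le_trans (ler_wpM2r p0 (ler_wpM2l c0 h)))//.
  rewrite le_eqVlt; apply/orP; left; apply/eqP; ring.
(* The k-th term of the expansion of f around x. *)
pose B k v := limn (series (fun n => sel x n k (A n) v)).
have cB k v : cvgn (series (fun n => sel x n k (A n) v)) /\
    `|B k v| <= (C / (1 - t)) / r' ^+ k * \prod_(i < k) `|v i|.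
  have K0 : 0 <= C / r' ^+ k * \prod_(i < k) `|v i|.
    by rewrite mulr_ge0 ?prodr_ge0// divr_ge0// exprn_ge0// ltW.
  have [cs] := geometric_series_cvg t01 K0 (fun n => sb n k v).
  split=> //; rewrite (le_trans b)// le_eqVlt; apply/orP; left; apply/eqP; ring.
have mB k : mlin k (B k).
  apply: (@mlin_lim _ _ _ (fun N v => series (fun n => sel x n k (A n) v) N)).
    by move=> N; apply: mlin_sum => n; exact: mlin_sel.
  by move=> w; exact: (cB k w).1.
exists (fun k v => B k (pad v)), (C / (1 - t)), r'; split=> //.
- by move=> n; exact: multilinear_pad.
- move=> n v; rewrite (le_trans (cB n _).2)//.
  by under eq_bigr do rewrite pad_ord.
move=> h hr'.
have -> : (fun n : nat => B n (@pad E n (fun=> h))) = fun n => B n (fun=> h).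
  apply/funext => n; apply: (mlin_local (mB n)) => i ni.
  by rewrite -[i]/(val (Ordinal ni)) pad_ord.
pose s := `|h| / r'.
have s01 : 0 <= s < 1 by rewrite divr_ge0 ?(ltW r'0)//= ltr_pdivrMr// mul1r.
have /andP[s0 s1] := s01.
have xhr : `|x + h| < r.
  rewrite (le_lt_trans (ler_normD _ _))//.
  by have : r' = (r - `|x|) / 2 by []; lra.
have sbh n k : `|sel x n k (A n) (fun=> h)| <= C * s ^+ k * t ^+ n.
  rewrite (le_trans (sb _ _ _))// prodr_const card_ord /s (expr_div_n _ r' k).
  rewrite le_eqVlt; apply/orP; left; apply/eqP; ring.
(* The error after K terms is estimated on partial sums in n: for n < N only k < K + N occur, and
   the part with k >= K is dominated by s^K times geometric sums in k and n. *)
have main K : `|f (x + h) - series (fun n => B n (fun=> h)) K| <=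
    (C / (1 - t) / (1 - s)) * s ^+ K.
  have lim1 : (fun N => series (fun n => A n (fun=> x + h)) N -
      \sum_(0 <= k < K) series (fun n => sel x n k (A n) (fun=> h)) N) @ \oo -->
      f (x + h) - series (fun n => B n (fun=> h)) K.
    apply: cvgB; first exact: Af.
    by apply: cvg_big => [|k _]; [exact: add_continuous|exact: (cB k _).1].
  apply: (cvgr_to_le (cvg_norm lim1)).
  apply: nearW => N; rewrite /series/= exchange_big/= -sumrB.
  have e n : (n < N)%N -> A n (fun=> x + h) - \sum_(0 <= k < K) sel x n k (A n) (fun=> h) =
      \sum_(j < N) sel x n (K + j) (A n) (fun=> h).
    move=> nN; rewrite -(@sel_sum _ _ _ x n (K + N) (A n) h)//; last by rewrite ltn_addl.
    by rewrite big_mkord big_split_ord/= [X in X - _]addrC addrK.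
  rewrite big_nat; under eq_bigr => n /andP[_ nN] do rewrite e//.
  rewrite -big_nat (le_trans (ler_norm_sum _ _ _))//.
  have T1 n : `|\sum_(j < N) sel x n (K + j) (A n) (fun=> h)| <=
      C / (1 - s) * s ^+ K * t ^+ n.
    rewrite (le_trans (ler_norm_sum _ _ _))//.
    rewrite (le_trans (ler_sum _ (fun (j : 'I_N) _ => sbh n (K + j)%N)))//.
    under eq_bigr do rewrite exprD.
    rewrite -mulr_suml; rewrite ler_wpM2r ?exprn_ge0//.
    under eq_bigr do rewrite mulrA.
    rewrite -mulr_sumr -[leRHS]mulrAC ler_wpM2l ?sum_geometric_le//.
    by rewrite mulr_ge0// exprn_ge0.
  rewrite (le_trans (ler_sum _ (fun n _ => T1 n)))// -mulr_sumr big_mkord.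
  have K0 : 0 <= C / (1 - s) * s ^+ K.
    by rewrite mulr_ge0 ?exprn_ge0// divr_ge0// subr_ge0 ltW.
  rewrite (le_trans (ler_wpM2l K0 (sum_geometric_le N t01)))//.
  rewrite le_eqVlt; apply/orP; left; apply/eqP; ring.
apply/cvgrPdist_le => e e0.
have cg : geometric (C / (1 - t) / (1 - s)) s @ \oo --> (0 : R).
  by apply: cvg_geometric; rewrite ger0_norm.
move/cvgrPdist_le : cg => /(_ e e0); apply: filterS => K.
rewrite sub0r normrN => h'; apply: le_trans (main K) _.
exact: le_trans (ler_norm _) h'.
Qed.

End Recentering.

(** * Norm estimates *)

Section WeightedSums.
Context {R : realType}.
Implicit Types (F G : ser R).

Lemma sum_shift (V : nmodType) (i N : nat) (q : nat -> V) : (i <= N)%N ->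
  \sum_(n < N) (if (i <= n)%N then q (n - i)%N else 0) = \sum_(j < N - i) q j.
Proof.
move=> iN; have [M ->] : exists M, N = (i + M)%N.
  by exists (N - i)%N; rewrite subnKC.
rewrite addKn big_split_ord/= big1 ?add0r => [|j _].
  by apply: eq_bigr => j _; rewrite leq_addr addKn.
by rewrite leqNgt ltn_ord.
Qed.

Lemma prod_ord_split (a N : nat) (F : nat -> R) : (a <= N)%N ->
  \prod_(i < N) F i = \prod_(i < a) F i * \prod_(i < N - a) F (a + i)%N.
Proof.
move=> aN; have [M ->] : exists M, N = (a + M)%N.
  by exists (N - a)%N; rewrite subnKC.
by rewrite addKn big_split_ord.
Qed.

(** Finite sums, so that the estimates precede any convergence. Each of the s pending factors will
    raise the degree by at least 2, which the shift 2s anticipates. *)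
Definition wsum s N F : R := \sum_(n < N) `|F n| / (n + 2 * s)`!%:R.

Lemma wsum_ge0 s N F : 0 <= wsum s N F.
Proof. by apply: sumr_ge0 => i _; rewrite divr_ge0. Qed.

Lemma wsum_le s N M F : (N <= M)%N -> wsum s N F <= wsum s M F.
Proof.
move=> NM; rewrite /wsum (big_ord_widen _ (fun n => `|F n| / (n + 2 * s)`!%:R) NM).
rewrite [leRHS](bigID (fun i : 'I_M => (i < N)%N))/= lerDl.
by apply: sumr_ge0 => i _; rewrite divr_ge0.
Qed.

Lemma fact_mul_le i m : (2 <= i)%N -> (i`! * (m + 2)`! <= 2 * (m + i)`!)%N.
Proof.
move=> i2; rewrite -(subnKC i2); elim: (i - 2)%N => [|j IHj].
  by rewrite addn0 leqnn.
have -> : (2 + j.+1 = (2 + j).+1)%N by rewrite addnS.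
have -> : (m + (2 + j).+1 = (m + (2 + j)).+1)%N by rewrite addnS.
rewrite (factS (2 + j)) (factS (m + (2 + j))) -mulnA [leqRHS]mulnCA.
by apply: leq_mul => //; rewrite ltnS leq_addl.
Qed.

Lemma wsum_mul s N F G : vanishes 2 F ->
  wsum s N (F * G) <= 2 * wsum 0 N F * wsum s.+1 N G.
Proof.
move=> F2; pose p n := `|F n| / (n + 2 * 0)`!%:R.
pose q n := `|G n| / (n + 2 * s.+1)`!%:R.
have p0 n : 0 <= p n by rewrite divr_ge0.
have q0 n : 0 <= q n by rewrite divr_ge0.
have step n : `|(F * G) n| / (n + 2 * s)`!%:R <=
    \sum_(i < n.+1) 2 * (p i * q (n - i)%N).
  rewrite serM ler_pdivrMr ?ltr0n ?fact_gt0// (le_trans (ler_norm_sum _ _ _))//.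
  rewrite mulr_suml; apply: ler_sum => i _; rewrite normrM.
  have [i2|i2] := ltnP i 2.
    by rewrite F2// normr0 mul0r !mulr_ge0.
  have ni : (i <= n)%N by rewrite -ltnS.
  have := fact_mul_le (n - i + 2 * s) i2.
  have -> : (n - i + 2 * s + 2 = n - i + 2 * s.+1)%N by lia.
  have -> : (n - i + 2 * s + i = n + 2 * s)%N by lia.
  rewrite -(ler_nat R) !natrM /p /q muln0 addn0 => h.
  set a : R := i`!%:R in h *; set b : R := (n - i + 2 * s.+1)`!%:R in h *.
  have a0 : 0 < a by rewrite ltr0n fact_gt0.
  have b0 : 0 < b by rewrite ltr0n fact_gt0.
  have -> : 2 * (`|F i| / a * (`|G (n - i)%N| / b)) * (n + 2 * s)`!%:R =
    (`|F i| * `|G (n - i)%N|) * ((2 * (n + 2 * s)`!%:R) / (a * b)).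
    by field; rewrite !gt_eqF.
  rewrite ler_peMr ?mulr_ge0// ler_pdivlMr ?mulr_gt0// mul1r.
  exact: h.
rewrite (le_trans (ler_sum _ (fun (n : 'I_N) _ => step n)))//.
(* The sums are regrouped by i, with j = n - i < N - i; extending the range of j to N can only
   increase them. *)
have -> : \sum_(n < N) \sum_(i < n.+1) 2 * (p i * q (n - i)%N) =
    2 * \sum_(i < N) (p i * \sum_(j < N - i) q j).
  rewrite mulr_sumr.
  under eq_bigr => n _ do
    rewrite (big_ord_widen _ (fun i => 2 * (p i * q (n - i)%N)) (ltn_ord n)) big_mkcond.
  rewrite exchange_big/=; apply: eq_bigr => i _.
  rewrite -(sum_shift _ (ltnW (ltn_ord i))) !mulr_sumr; apply: eq_bigr => n _.
  by rewrite ltnS; case: ifP; rewrite ?mulr0.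
rewrite -mulrA ler_wpM2l// mulr_suml; apply: ler_sum => i _.
rewrite ler_wpM2l//; exact: (wsum_le _ _ (leq_subr _ _)).
Qed.

Lemma wsum_prod k s N (w : nat -> nat -> R) G :
  wsum s N (\prod_(i < k) (tail (w i) : ser R) * G) <=
  2 ^+ k * \prod_(i < k) wsum 0 N (tail (w i)) * wsum (s + k) N G.
Proof.
elim: k G => [|k IHk] G; first by rewrite !big_ord0 addn0 !mul1r.
rewrite big_ord_recr/= -mulrA (le_trans (IHk _))//.
have h := wsum_mul (s + k) N G (@vanishes_tail R (w k)).
have p0 : 0 <= 2 ^+ k * \prod_(i < k) wsum 0 N (tail (w i)).
  by rewrite mulr_ge0 ?exprn_ge0// prodr_ge0// => i _; exact: wsum_ge0.
rewrite (le_trans (ler_wpM2l p0 h))// big_ord_recr/= addnS exprSr.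
rewrite le_eqVlt; apply/orP; left; apply/eqP; ring.
Qed.

(** C(n, k) <= C(n + k, k), and C(n + k, k) k! n! = (n + k)!. *)
Lemma bin_fact_le n k : ('C(n, k) * n`! <= (n + k)`!)%N.
Proof.
have h : ('C(n + k, k) * (k`! * n`!) = (n + k)`!)%N.
  by have := @bin_fact (n + k) k (leq_addl n k); rewrite addnK.
rewrite -h leq_mul//; first by rewrite leq_bin2l// leq_addr.
by rewrite leq_pmull// fact_gt0.
Qed.

(** With k factors pending, the weight 1 / (n + 2k)! is small enough to absorb the binomial
    coefficient of the divided derivative. *)
Lemma wsum_hasse k N F : wsum k N (hasse k F) <= wsum 0 (N + k) F.
Proof.
rewrite /wsum (addnC N k) big_split_ord/= -[leLHS]add0r lerD//.
  by apply: sumr_ge0 => i _; rewrite divr_ge0.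
apply: ler_sum => n _; rewrite /hasse normrM normr_nat muln0 addn0 addnC.
have := bin_fact_le (k + n) k.
rewrite (_ : (k + n + k = n + 2 * k)%N); last by lia.
rewrite -(ler_nat R) natrM => h.
rewrite ler_pdivrMr ?ltr0n ?fact_gt0// mulrAC ler_pdivlMr ?ltr0n ?fact_gt0//.
by rewrite mulrAC [leRHS]mulrC ler_wpM2r.
Qed.

Lemma wsum_tail (a : nat -> R) N : wsum 0 N.+2 (tail a) = series (W1_term a) N.
Proof.
rewrite /wsum !big_ord_recl/= !normr0 !mul0r !add0r /series/= big_mkord.
by apply: eq_bigr => i _; rewrite /W1_term muln0 addn0.
Qed.

Lemma wsum_tail_le (a : W1 R) N : wsum 0 N (tail a) <= `|a|.
Proof.
apply: le_trans (wsum_le 0 _ (leq_addr 2 N)) _.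
by rewrite addn2 wsum_tail W1_norm_ub.
Qed.

Lemma W1_of_bound (a : nat -> R) (M : R) :
  (forall N, series (W1_term a) N <= M) -> a \in @W1_pred R.
Proof.
move=> aM; apply/W1_predP/nondecreasing_is_cvgn.
  by apply: nondecreasing_series => i _ _; exact: W1_term_ge0.
by exists M => _ [n _ <-]; exact: aM.
Qed.

Lemma W1_norm_le (a : W1 R) (M : R) :
  (forall N, series (W1_term a) N <= M) -> `|a| <= M.
Proof.
move=> aM; rewrite W1_normE; apply: limr_le; first exact: W1P.
exact: nearW.
Qed.

Definition subst_term k (w : nat -> W1 R) (f : W1 R) : ser R :=
  \prod_(i < k) (tail (w i) : ser R) * hasse k (tail f).

Lemma subst_term_bound k w f N :
  wsum 0 N (subst_term k w f) <= 2 ^+ k * \prod_(i < k) `|w i| * `|f|.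
Proof.
rewrite /subst_term (le_trans (wsum_prod k 0 N (fun i => w i) _))// add0n ler_pM//.
- by rewrite mulr_ge0 ?exprn_ge0// prodr_ge0// => i _; exact: wsum_ge0.
- exact: wsum_ge0.
- rewrite ler_wpM2l ?exprn_ge0// ler_prod// => i _.
  by rewrite wsum_ge0 wsum_tail_le.
- by rewrite (le_trans (wsum_hasse _ _ _))// wsum_tail_le.
Qed.

Lemma vanishes_prod_tail k (w : nat -> nat -> R) :
  vanishes (2 * k) (\prod_(i < k) (tail (w i) : ser R)).
Proof.
elim: k => [|k IHk]; first by move=> n; rewrite muln0.
rewrite big_ord_recr mulnS addnC; apply: vanishes_mul => //.
exact: vanishes_tail.
Qed.

Lemma tail_shift F : vanishes 2 F -> tail (fun i => F i.+2) = F.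
Proof. by move=> F2; apply/funext => -[|[|n]] //=; rewrite F2. Qed.

Lemma vanishes_subst_term k w f : vanishes 2 (subst_term k.+1 w f).
Proof.
move=> n n2; rewrite /subst_term; apply: (@causal_mulr _ _ 2%N) => // i i2.
apply: (@vanishes_prod_tail k.+1 (fun i => w i)); lia.
Qed.

Lemma subst_term_W1 k w f : (fun i => subst_term k.+1 w f i.+2) \in @W1_pred R.
Proof.
apply: (@W1_of_bound _ (2 ^+ k.+1 * \prod_(i < k.+1) `|w i| * `|f|)) => N.
rewrite -wsum_tail tail_shift ?subst_term_bound//.
exact: vanishes_subst_term.
Qed.

(** The index k stands for k + 1 factors, as in [taylor]. The product has order at least 2, so
    passing to [W1] loses no coefficient. *)
Definition substW k w f : W1 R := MkW1 (subst_term_W1 k w f).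

Lemma tail_substW k w f : tail (substW k w f) = subst_term k.+1 w f.
Proof. exact/tail_shift/vanishes_subst_term. Qed.

Lemma substW_norm k w f :
  `|substW k w f| <= 2 ^+ k.+1 * \prod_(i < k.+1) `|w i| * `|f|.
Proof.
apply: W1_norm_le => N; rewrite -wsum_tail tail_substW.
exact: subst_term_bound.
Qed.

Definition tailW (f : W1 R) : ser R := tail f.

Lemma tailW_linear : linear tailW.
Proof.
move=> a f g; apply/funext => -[|[|n]] //=.
  by rewrite serD serZ /= mulr0 addr0.
by rewrite serD serZ /= mulr0 addr0.
Qed.
HB.instance Definition _ := GRing.isLinear.Build R (W1 R) (ser R) *:%R
  tailW tailW_linear.

Lemma tailW_inj : injective tailW.
Proof.
move=> f g fg; apply/val_inj/funext => i.
exact: (congr1 (fun F : ser R => F i.+2) fg).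
Qed.

Lemma tailW_coef_le (f : W1 R) n : `|tailW f n| <= n`!%:R * `|f|.
Proof.
case: n => [|[|n]]; [by rewrite normr0 mulr_ge0..|].
exact: W1_coord_le.
Qed.

Lemma substW0 k w : substW k w 0 = 0.
Proof.
apply: tailW_inj; rewrite linear0 /tailW tail_substW /subst_term.
by rewrite -[tail 0]/(tailW 0) !linear0 mulr0.
Qed.

End WeightedSums.

(** * Homogeneous terms of power series in an operator *)

Section HomogeneousTerms.
Context {R : realType}.
Variables c e : nat -> R.

(* The part of degree d in h of D^m(h), where D(F) is the sum over k of
   c_k h^(k+1) F^(k+1) / (k+1)!, made multilinear. *)
Fixpoint term (m d : nat) (w : nat -> W1 R) : W1 R :=
  if m is m'.+1 then
    \sum_(k < d) c k *: substW k w (term m' (d - k.+1) (fun i => w (k.+1 + i)%N))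
  else if d == 1%N then w 0%N else 0.

(** The innermost h has degree 1 and each of the m applications of D adds at least one degree. *)
Lemma term_small m d w : (d <= m)%N -> term m d w = 0.
Proof.
elim: m d w => [|m IHm] d w /=; first by rewrite leqn0 => /eqP ->.
move=> dm; apply: big1 => k _; rewrite IHm ?substW0 ?scaler0//.
by move: (ltn_ord k); lia.
Qed.

Lemma mlin_mull n (G : ser R) (P : (nat -> W1 R) -> ser R) :
  mlin n P -> mlin n (fun w => G * P w).
Proof.
elim: n P => [|n IHn] P /=; first by move=> mP w w'; rewrite (mP w w').
move=> [lP mP]; split=> [w a u v|x]; first by rewrite lP mulrDr scalerAr.
exact: (IHn _ (mP x)).
Qed.

Lemma mlin_mul_hasse (k j l : nat) (P : (nat -> W1 R) -> ser R) (Q : (nat -> W1 R) -> W1 R) :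
  mlin k P -> mlin l Q ->
  mlin (k + l) (fun w => P w * hasse j (tailW (Q (fun i => w (k + i)%N)))).
Proof.
elim: k P => [|k IHk] P /=.
  move=> mP mQ.
  rewrite (_ : (fun _ => _) = fun w => P (fun=> 0) * hasse j (tailW (Q w))).
    exact/mlin_mull/mlin_comp/mlin_comp.
  by apply/funext => w; rewrite (mP w (fun=> 0)).
move=> [lP mP] mQ; split=> [w a u v|x]; first by rewrite lP mulrDl -scalerAl.
exact: (IHk _ (mP x) mQ).
Qed.

Lemma mlin_prod_tail k : mlin k (fun w : nat -> W1 R => \prod_(i < k) tailW (w i)).
Proof.
elim: k => [|k IHk]; first by move=> w w'; rewrite !big_ord0.
have E x w : \prod_(i < k.+1) tailW (scons x w i) = tailW x * \prod_(i < k) tailW (w i).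
  by rewrite big_ord_recl.
split=> [w a u v|x]; first by rewrite !E linearP mulrDl -scalerAl.
by under eq_fun do rewrite E; exact: mlin_mull.
Qed.

Lemma mlin_term m d : mlin d (term m d).
Proof.
elim: m d => [|m IHm] d /=.
  case: d => [|[|d]] //=; last exact: (@mlin0 _ _ _ d.+2).
rewrite (_ : (fun _ => _) = fun w => \sum_(k < d)
   c k *: (fun w => substW k w (term m (d - k.+1) (fun i => w (k.+1 + i)%N))) w)//.
apply: mlin_sum => k; apply: mlinZ; apply: (mlin_inj tailW_inj).
rewrite [X in mlin _ X](_ : _ = fun w : nat -> W1 R => \prod_(i < k.+1) tailW (w i) *
    hasse k.+1 (tailW (term m (d - k.+1) (fun i => w (k.+1 + i)%N)))); last first.
  by apply/funext => w; exact: tail_substW.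
(* The first k + 1 arguments enter the product, the remaining d - (k + 1) the inner term. *)
rewrite -[X in mlin X _](subnKC (ltn_ord k)).
exact: (mlin_mul_hasse k.+1 (mlin_prod_tail k.+1) (IHm _)).
Qed.

(** q majorizes D on the ball of radius r, the 2 in 2r coming from [substW_norm]. Hence r q^m
    majorizes D^m(h), and its part of degree d carries 1 / r^d. *)
Lemma term_bound (r q : R) m d w : 0 < r ->
  (forall N, \sum_(k < N) `|c k| * (2 * r) ^+ k.+1 <= q) ->
  `|term m d w| <= r * q ^+ m / r ^+ d * \prod_(i < d) `|w i|.
Proof.
move=> r0 cq; have rn0 n : r ^+ n != 0 by rewrite expf_neq0// gt_eqF.
have q0 : 0 <= q by have := cq 0%N; rewrite big_ord0.
elim: m d w => [|m IHm] d w /=.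
  have p0 : 0 <= r * q ^+ 0 / r ^+ d * \prod_(i < d) `|w i|.
    by rewrite mulr_ge0 ?prodr_ge0// divr_ge0 ?expr0 ?mulr1 ?exprn_ge0// ltW.
  case: eqP => [->|_]; last by rewrite normr0.
  by rewrite big_ord1 expr0 expr1 mulr1 divff ?mul1r// gt_eqF.
set p := \prod_(i < d) `|w i|.
have p0 : 0 <= p by exact: prodr_ge0.
have step (k : 'I_d) : `|c k *: substW k w (term m (d - k.+1) (fun i => w (k.+1 + i)%N))| <=
    (`|c k| * (2 * r) ^+ k.+1) * (r * q ^+ m / r ^+ d * p).
  rewrite normrZ -mulrA ler_wpM2l//.
  apply: le_trans (substW_norm _ _ _) _.
  have s0 : 0 <= 2 ^+ k.+1 * \prod_(i < k.+1) `|w i|.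
    by rewrite mulr_ge0 ?exprn_ge0// prodr_ge0.
  rewrite (le_trans (ler_wpM2l s0 (IHm _ _)))//.
  have -> : p = \prod_(i < k.+1) `|w i| * \prod_(i < d - k.+1) `|w (k.+1 + i)%N|.
    exact: prod_ord_split (fun i => `|w i|) (ltn_ord k).
  have -> : r ^+ d = r ^+ k.+1 * r ^+ (d - k.+1) by rewrite -exprD subnKC.
  rewrite exprMn le_eqVlt; apply/orP; left; apply/eqP.
  by field; rewrite ?rn0 ?gt_eqF.
rewrite (le_trans (ler_norm_sum _ _ _))// (le_trans (ler_sum _ (fun k _ => step k)))//.
rewrite -mulr_suml.
have K0 : 0 <= r * q ^+ m / r ^+ d * p.
  by rewrite mulr_ge0// divr_ge0 ?mulr_ge0 ?exprn_ge0// ltW.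
rewrite (le_trans (ler_wpM2r K0 (cq d)))// exprS le_eqVlt.
by apply/orP; left; apply/eqP; ring.
Qed.

(** The part of degree d of the sum of all e_m D^m(h); by [term_small] the terms with m >= d are
    0. *)
Definition homog (d : nat) w : W1 R := \sum_(m < d) e m *: term m d w.

Lemma mlin_homog d : mlin d (homog d).
Proof. by apply: mlin_sum => m; apply: mlinZ; exact: mlin_term. Qed.

Lemma homog_bound (r q K : R) d w : 0 < r ->
  (forall N, \sum_(k < N) `|c k| * (2 * r) ^+ k.+1 <= q) ->
  (forall N, \sum_(m < N) `|e m| * q ^+ m <= K) ->
  `|homog d w| <= r * K / r ^+ d * \prod_(i < d) `|w i|.
Proof.
move=> r0 cq eK.
rewrite /homog (le_trans (ler_norm_sum _ _ _))//.
under eq_bigr do rewrite normrZ.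
rewrite (le_trans (ler_sum _ (fun (m : 'I_d) _ => ler_wpM2l (normr_ge0 (e m)) (term_bound m d w r0 cq))))//.
set p := \prod_(i < d) `|w i|.
have p0 : 0 <= r / r ^+ d * p.
  by rewrite mulr_ge0 ?prodr_ge0// divr_ge0 ?exprn_ge0 ?ltW.
have -> : \sum_(m < d) `|e m| * (r * q ^+ m / r ^+ d * p) =
   (\sum_(m < d) `|e m| * q ^+ m) * (r / r ^+ d * p).
  by rewrite mulr_suml; apply: eq_bigr => m _; ring.
rewrite (le_trans (ler_wpM2r p0 (eK d)))// le_eqVlt.
by apply/orP; left; apply/eqP; ring.
Qed.

Lemma sum_term (h : W1 R) m N n : (n < N)%N ->
  \sum_(d < N) tailW (term m d (fun=> h)) n = iter m (taylor c (tailW h)) (tailW h) n.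
Proof.
have h2 := @vanishes_tail R h.
elim: m N n => [|m IHm] N n nN.
  case: N nN => [//|[|N]] nN.
    by rewrite big_ord1/= linear0; case: n nN.
  rewrite (bigD1 (@Ordinal N.+2 1 isT))//= big1 ?addr0// => d.
  by rewrite -val_eqE/= => /negPf ->; rewrite linear0.
rewrite iterS (taylor_widen _ h2 _ (ltnW nN)).
pose g k j := (tailW h ^+ k.+1 * hasse k.+1 (tailW (term m j (fun=> h)))) n.
have -> : \sum_(d < N) tailW (term m.+1 d (fun=> h)) n =
    \sum_(d < N) \sum_(k < N) c k * (if (k.+1 <= d)%N then g k (d - k.+1)%N else 0).
  apply: eq_bigr => d _.
  rewrite linear_sum ser_sum.
  rewrite (big_ord_widen _ (fun k => (tailW (c k *: substW k (fun=> h) (term m (d - k.+1) (fun=> h)))) n) (ltnW (ltn_ord d))).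
  rewrite big_mkcond/=; apply: eq_bigr => k _; case: ltnP => _; last by rewrite mulr0.
  rewrite linearZ/= serZ /tailW tail_substW /subst_term prodr_const card_ord.
  by [].
rewrite exchange_big/=; apply: eq_bigr => k _; rewrite -mulr_sumr; congr (_ * _).
rewrite (sum_shift (g k) (ltn_ord k)).
set S := \sum_(j < N - k.+1) tailW (term m j (fun=> h)); set W := iter m _ _.
have -> : \sum_(j < N - k.+1) g k j = (tailW h ^+ k.+1 * hasse k.+1 S) n.
  by rewrite linear_sum mulr_sumr ser_sum.
(* By induction S and W agree below degree N - (k + 1). Taking the divided derivative and
   multiplying by the power of h raises the order of S - W by k + 1, past n. *)
apply/eqP; rewrite -subr_eq0.
have -> : (tailW h ^+ k.+1 * hasse k.+1 S) n - (tailW h ^+ k.+1 * hasse k.+1 W) n =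
   (tailW h ^+ k.+1 * hasse k.+1 (S - W)) n.
  by rewrite linearB mulrBr.
rewrite (vanishes_hasse_term h2)// => i ikn.
rewrite -[(S - W) i]/(S i - W i) /S ser_sum /W -(IHm (N - k.+1)%N) ?subrr//.
by move: (ltn_ord k); lia.
Qed.

Definition homog_sum (h : W1 R) : W1 R := limn (series (fun d => homog d (fun=> h))).

(** Coefficient n of the partial sums is constant from index n + 1 on, and taking a coefficient is
    continuous for the norm of [W1]. *)
Lemma homog_sum_coef (h : W1 R) N n :
  cvgn (series (fun d => homog d (fun=> h))) -> (n < N)%N ->
  tailW (homog_sum h) n = \sum_(m < N) e m * iter m (taylor c (tailW h)) (tailW h) n.
Proof.
move=> ch nN.
have part M : (n < M)%N -> tailW (series (fun d => homog d (fun=> h)) M) n =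
    \sum_(m < M) e m * iter m (taylor c (tailW h)) (tailW h) n.
  move=> nM; rewrite /series/= big_mkord linear_sum ser_sum.
  have -> : \sum_(d < M) tailW (homog d (fun=> h)) n =
      \sum_(d < M) \sum_(m < M) e m * tailW (term m d (fun=> h)) n.
    apply: eq_bigr => d _; rewrite /homog.
    rewrite (big_ord_widen _ (fun m => e m *: term m d (fun=> h)) (ltnW (ltn_ord d))).
    rewrite big_mkcond linear_sum ser_sum; apply: eq_bigr => m _.
    case: ltnP => [_|dm]; first by rewrite linearZ.
    by rewrite term_small// !linear0 mulr0.
  rewrite exchange_big/=; apply: eq_bigr => m _.
  by rewrite -mulr_sumr sum_term.
have z m : (n < m)%N -> iter m (taylor c (tailW h)) (tailW h) n = 0.
  by apply: raising_iter; exact/taylor_raising/vanishes_tail.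
have part' M : (n < M)%N -> \sum_(m < M) e m * iter m (taylor c (tailW h)) (tailW h) n =
    \sum_(m < n.+1) e m * iter m (taylor c (tailW h)) (tailW h) n.
  move=> nM; rewrite [RHS](big_ord_widen _ (fun m => e m * iter m (taylor c (tailW h)) (tailW h) n) nM).
  rewrite [RHS]big_mkcond/=; apply: eq_bigr => m _; case: ltnP => // nm.
  by rewrite z ?mulr0.
(* A nonzero difference x would persist in all late partial sums, whereas |x| is at most n! times
   their distance to the limit. *)
apply/eqP; rewrite -subr_eq0 part'//; apply/negPn/negP => x0.
set x := _ - _ in x0.
have fn : 0 < n`!%:R :> R by rewrite ltr0n fact_gt0.
have d0 : 0 < `|x| / n`!%:R by rewrite divr_gt0// normr_gt0.
have /filter_ex[M [LM nM]] : \forall M \near \oo,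
    `|homog_sum h - series (fun d => homog d (fun=> h)) M| < `|x| / n`!%:R /\ (n < M)%N.
  near=> M; split; last by near: M; exact: nbhs_infty_gt.
  by near: M; move/cvgrPdist_lt : ch => /(_ _ d0).
move: LM; rewrite ltr_pdivlMr// mulrC ltNge => /negP; apply.
have -> : x = tailW (homog_sum h - series (fun d => homog d (fun=> h)) M) n.
  by rewrite linearB/= /x -(part' M nM) -(part M nM).
exact: tailW_coef_le.
Unshelve. all: by end_near. Qed.

End HomogeneousTerms.

(** * Analyticity of exp and log *)

Section Analyticity.
Context {R : realType}.
Variables (c e : nat -> R) (r q K : R).
Hypotheses (r0 : 0 < r)
  (cq : forall N, \sum_(k < N) `|c k| * (2 * r) ^+ k.+1 <= q)
  (eK : forall N, \sum_(m < N) `|e m| * q ^+ m <= K).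

Lemma homog_series_cvg (h : W1 R) : `|h| < r ->
  series (fun d => homog c e d (fun=> h)) @ \oo --> homog_sum c e h.
Proof.
move=> hr; have K0 : 0 <= K by have := eK 0%N; rewrite big_ord0.
have t01 : 0 <= `|h| / r < 1 by rewrite divr_ge0 ?(ltW r0)//= ltr_pdivrMr// mul1r.
have C0 : 0 <= r * K by rewrite mulr_ge0// ltW.
apply: (geometric_series_cvg t01 C0 _).1 => d.
rewrite (le_trans (homog_bound d _ r0 cq eK))// prodr_const card_ord expr_div_n.
by rewrite le_eqVlt; apply/orP; left; apply/eqP; ring.
Qed.

Lemma homog_sum_analytic (h : W1 R) : `|h| < r -> analytic_at (homog_sum c e) h.
Proof.
apply: (power_series_analytic_at r0 (fun n => @mlin_homog R c e n)
  (fun n w => homog_bound n w r0 cq eK)).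
exact: homog_series_cvg.
Qed.

End Analyticity.

(** * The coefficients and radii for exp and log *)

Section ExpLog.
Context {R : realType}.

(** D is h d/dx for exp and T - 1 for log, with D x = h in both cases. One application of D is spent
    on x, so exp(D) x - x is the sum of D^m h / (m + 1)!, and ln(1 + D) x that of (-1)^m D^m h / (m
    + 1). *)
Definition exp_coefs (k : nat) : R := (k == 0)%N%:R.
Definition exp_weights (m : nat) : R := (m.+1)`!%:R^-1.
Definition log_coefs (k : nat) : R := 1.
Definition log_weights (m : nat) : R := (-1) ^+ m / m.+1%:R.

Lemma exp_coefs_sum (r : R) N : 0 < r ->
  \sum_(k < N) `|exp_coefs k| * (2 * r) ^+ k.+1 <= 2 * r.
Proof.
move=> r0; case: N => [|N]; first by rewrite big_ord0 mulr_ge0// ltW.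
rewrite big_ord_recl big1 ?addr0 => [|k _]; first by rewrite normr1 mul1r expr1.
by rewrite normr0 mul0r.
Qed.

Lemma exp_weights_sum (q : R) N : 0 <= q ->
  \sum_(m < N) `|exp_weights m| * q ^+ m <= expR q.
Proof.
move=> q0; apply: (@le_trans _ _ (series (exp_coeff q) N)).
  rewrite /series/= big_mkord; apply: ler_sum => m _.
  rewrite /exp_coeff/= mulrC ler_wpM2l ?exprn_ge0// /exp_weights ger0_norm ?invr_ge0//.
  by rewrite lef_pV2 ?posrE ?ltr0n ?fact_gt0// ler_nat factS leq_pmull.
apply: nondecreasing_cvgn_le; last exact: is_cvg_series_exp_coeff.
by apply: nondecreasing_series => n _ _; exact: exp_coeff_ge0.
Qed.

Lemma exp_analytic (x : W1 R) : analytic_at (homog_sum exp_coefs exp_weights) x.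
Proof.
(* Every radius r is admissible for exp, with q = 2r and K = e^q; one beyond |x| is taken. *)
have r0 : 0 < `|x| + 1 :> R by rewrite ltr_wpDl.
apply: (homog_sum_analytic r0 (fun N => exp_coefs_sum N r0)
  (fun N => exp_weights_sum N _)); last by rewrite ltrDl.
by rewrite mulr_ge0// ltW.
Qed.

Lemma exp_series_cvg (x : W1 R) :
  cvgn (series (fun d => homog exp_coefs exp_weights d (fun=> x))).
Proof.
have r0 : 0 < `|x| + 1 :> R by rewrite ltr_wpDl.
apply/cvg_ex; exists (homog_sum exp_coefs exp_weights x).
apply: (homog_series_cvg r0 (fun N => exp_coefs_sum N r0)
  (fun N => exp_weights_sum N _)); last by rewrite ltrDl.
by rewrite mulr_ge0// ltW.
Qed.

Lemma formal_exp_homog_sum (b : W1 R) : formal_exp b (homog_sum exp_coefs exp_weights b).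
Proof.
apply: formal_exp_of_X; rewrite diff_seriesE; apply/funext => n; rewrite serD.
rewrite -[tail _]/(tailW _) (homog_sum_coef (@exp_series_cvg b) (ltnSn n)).
rewrite (exp_op_widen (@vfield_op_raising _ b) _ (leqnSn n.+1)) [RHS]big_ord_recl.
congr (_ + _); first by rewrite /iter_fact/= fact0 invr1 scale1r.
apply: eq_bigr => m _; rewrite lift0 /iter_fact iterSr serZ; congr (_ * _).
have -> : vfield_op b serX = tailW b :> ser R.
  by rewrite -[serX]expr1 vfield_op_Xn expr0 mul1r.
congr (iter m _ _ n); apply/funext => F.
by rewrite vfield_op_taylor.
Qed.

(** For r = 1/8 the ratio 2r = 1/4 gives at most 1/3, so q = 1/2 is a valid bound below 1, inside
    the disc of convergence of ln(1 + u). *)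
Lemma log_coefs_sum N : \sum_(k < N) `|log_coefs k| * (2 * 8^-1 : R) ^+ k.+1 <= 2^-1.
Proof.
have t01 : 0 <= (2 * 8^-1 : R) < 1 by lra.
under eq_bigr do rewrite normr1 mul1r exprS.
have h := sum_geometric_le N t01.
have e : (1 - 2 * 8^-1)^-1 = 4 / 3 :> R.
  by have -> : 1 - 2 * 8^-1 = (4 / 3)^-1 :> R; [rewrite invf_div; lra|rewrite invrK].
rewrite -mulr_sumr; rewrite e in h; lra.
Qed.

Lemma log_weights_sum N : \sum_(m < N) `|log_weights m| * (2^-1 : R) ^+ m <= 2.
Proof.
have t01 : 0 <= (2^-1 : R) < 1 by lra.
apply: (@le_trans _ _ (\sum_(m < N) (2^-1 : R) ^+ m)).
  apply: ler_sum => m _; rewrite ler_piMl ?exprn_ge0//.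
  rewrite /log_weights normrM normrX normrN1 expr1n mul1r ger0_norm ?invr_ge0//.
  by rewrite invf_le1 ?ltr0n// ler1n.
have := sum_geometric_le N t01.
by have -> : 1 - 2^-1 = 2^-1 :> R; [lra|rewrite invrK].
Qed.

Lemma log_analytic (x : W1 R) : `|x| < 8^-1 ->
  analytic_at (homog_sum log_coefs log_weights) x.
Proof.
by apply: (homog_sum_analytic _ log_coefs_sum log_weights_sum); lra.
Qed.

Lemma log_series_cvg (x : W1 R) : `|x| < 8^-1 ->
  cvgn (series (fun d => homog log_coefs log_weights d (fun=> x))).
Proof.
move=> x8; apply/cvg_ex; exists (homog_sum log_coefs log_weights x).
by apply: (homog_series_cvg _ log_coefs_sum log_weights_sum) => //; lra.
Qed.

Lemma formal_log_homog_sum (a : W1 R) : `|a| < 8^-1 ->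
  formal_log a (homog_sum log_coefs log_weights a).
Proof.
move=> a8; apply: formal_log_of_X; apply/funext => n.
rewrite -[tail _]/(tailW _) (homog_sum_coef (log_series_cvg a8) (ltnSn n)).
rewrite (log_op_widen _ _ (leqnSn n)); apply: eq_bigr => m _; congr (_ * _).
rewrite iterSr; congr (iter m _ _ n).
have := subst_op_taylor a serX; rewrite subst_op_X.
by rewrite diff_seriesE => /addrI.
Qed.

End ExpLog.

Theorem proposition1p2 (R : realType) :
  (exists Exp : vect1 R -> Diff1 R,
     (forall L : vect1 R, formal_exp L (Exp L)) /\ analytic_on setT Exp)
  /\
  (exists (U : set (Diff1 R)) (Log : Diff1 R -> vect1 R),
     [/\ open_nbhs 0 U,
         forall gamma : Diff1 R, U gamma -> formal_log gamma (Log gamma) &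
         analytic_on U Log]).
Proof.
split.
  exists (homog_sum exp_coefs exp_weights); split=> [L|x _].
    exact: formal_exp_homog_sum.
  exact: exp_analytic.
have bE (x : W1 R) : ball (0 : W1 R) 8^-1 x -> `|x| < 8^-1.
  by rewrite -ball_normE/= sub0r normrN.
(* The unity x has all a_j = 0, so neighborhoods of it are neighborhoods of 0 in [W1]. *)
exists (ball (0 : W1 R) 8^-1), (homog_sum log_coefs log_weights); split.
- split; first by apply: ball_open; lra.
  by apply: ballxx; lra.
- by move=> a /bE; exact: formal_log_homog_sum.
- by move=> a /bE; exact: log_analytic.
Qed.
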